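(* Let $R$ be a Dedekind domain with fraction field $K$, let $R[x]=R[x_1,\dots,x_n]$ be equipped with a monomial ordering $<$, and let $F=(f_i,\mathfrak f_i)_{1\le i\le l}$ be a finite family of non-zero pseudo-polynomials of $R[x]$. Consider the following procedure: (1) Initialize $\tilde G=\{((f_i,\mathfrak f_i),(f_j,\mathfrak f_j))\mid 1\le i<j\le l\}$ and $G=F$. (2) While $\tilde G\neq\emptyset$, repeat: (a) pick a pair $((f,\mathfrak f),(g,\mathfrak g))\in\tilde G$, remove it from $\tilde G$, and compute a pseudo-polynomial $(h,\mathfrak h)$ such that $\operatorname{spoly}((f,\mathfrak f),(g,\mathfrak g))$ reduces to $(h,\mathfrak h)$ modulo $G$ and either $h=0$ or $(h,\mathfrak h)$ is minimal with respect to $G$; (b) if $h\neq0$, replace $\tilde G$ by $\tilde G\cup\{((f,\mathfrak f),(h,\mathfrak h))\mid(f,\mathfrak f)\in G\}$ and then $G$ by $G\cup\{(h,\mathfrak h)\}$. (3) Return $G$. Then (for any choices made in step (a)) this procedure terminates after finitely many steps, and the returned $G$ is a pseudo-Gröbner basis of $\langle F\rangle$.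
   Context: A Dedekind domain is a Noetherian integrally closed domain of Krull dimension one. A monomial ordering is a total well-ordering on monomials compatible with multiplication. For non-zero $f=\sum_\alpha c_\alpha x^\alpha\in K[x]$, $\deg(f)\in\mathbb N^n$ is the largest exponent $\alpha$ (with respect to $<$) with $c_\alpha\ne0$; $\operatorname{lm}(f)=x^{\deg(f)}$, $\operatorname{lc}(f)=c_{\deg(f)}$, $\operatorname{lt}(f)=\operatorname{lc}(f)\operatorname{lm}(f)$. A fractional ideal of $R$ is a non-zero finitely generated $R$-submodule of $K$; for a fractional ideal $\mathfrak a$, $\mathfrak a[x]$ is the set of polynomials in $K[x]$ with all coefficients in $\mathfrak a$. A pseudo-polynomial of $R[x]$ is a pair $(f,\mathfrak f)$ with $f\in K[x]$ and $\mathfrak f$ a fractional ideal of $R$ such that $\mathfrak f f\subseteq R[x]$; it is zero if $f=0$. Put $\operatorname{lc}(f,\mathfrak f)=\mathfrak f\operatorname{lc}(f)$ and $\langle(f,\mathfrak f)\rangle=\mathfrak f[x]f$; for a finite family $G=(g_i,\mathfrak g_i)_i$ put $\langle G\rangle=\sum_i\mathfrak g_i[x]g_i$. Reduction: let $(f,\mathfrak f)$ and $G=\{(g_i,\mathfrak g_i)\}$ be non-zero pseudo-polynomials and $J=\{i\mid \operatorname{lm}(g_i)\text{ divides }\operatorname{lm}(f)\}$. $(f,\mathfrak f)$ can be reduced modulo $G$ if $\operatorname{lc}(f,\mathfrak f)\subseteq\sum_{i\in J}\operatorname{lc}(g_i,\mathfrak g_i)$, and is minimal with respect to $G$ otherwise.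 Reducibility is equivalent to the existence of $a_i\in\mathfrak g_i\mathfrak f^{-1}$, $i\in J$, with $\operatorname{lc}(f)=\sum_{i\in J}a_i\operatorname{lc}(g_i)$; for any such choice, $(f-\sum_{i\in J}a_ix^{\deg(f)-\deg(g_i)}g_i,\ \mathfrak f)$ is called a one step reduction of $(f,\mathfrak f)$. $(f,\mathfrak f)$ reduces to $(h,\mathfrak f)$ modulo $G$ if $(h,\mathfrak f)$ is obtained from $(f,\mathfrak f)$ by a finite (possibly empty) chain of one step reductions. Pseudo-Gröbner basis: $\operatorname{Lt}(g,\mathfrak g)=\mathfrak g[x]\operatorname{lt}(g)$, $\operatorname{Lt}(G)=\sum_i\operatorname{Lt}(g_i,\mathfrak g_i)$, and for an ideal $I$ of $R[x]$, $\operatorname{Lt}(I)$ is the ideal generated by the leading terms of the non-zero elements of $I$. A finite set $G$ of non-zero pseudo-polynomials with $\langle G\rangle\subseteq I$ is a pseudo-Gröbner basis of $I$ if $\operatorname{Lt}(I)=\operatorname{Lt}(G)$. S-polynomial: for non-zero pseudo-polynomials $(f,\mathfrak f)$, $(g,\mathfrak g)$ and $m=\operatorname{lcm}(\operatorname{lm}(f),\operatorname{lm}(g))$, $$\operatorname{spoly}((f,\mathfrak f),(g,\mathfrak g))=\Bigl(\tfrac{m}{\operatorname{lm}(f)}\tfrac1{\operatorname{lc}(f)}f-\tfrac{m}{\operatorname{lm}(g)}\tfrac1{\operatorname{lc}(g)}g,\ \operatorname{lc}(f)\mathfrak f\cap\operatorname{lc}(g)\mathfrak g\Bigr).$$ 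*)

(* Defs.v *)
From HB Require Import structures.
From mathcomp Require Import all_boot all_order all_algebra.
From mathcomp Require Import boolp classical_sets.
From mathcomp Require Import mpoly.
From Stdlib Require Import Relation_Operators.
Set Implicit Arguments.
Unset Strict Implicit.
Unset Printing Implicit Defensive.
Import GRing.Theory.
Local Open Scope ring_scope.
Local Open Scope classical_set_scope.

(* Finite sums of products [s * x] with [s] in [S] and [x] in [X]: this is the
   [S]-submodule generated by [X] when [S] is a subring, and the usual product
   [S X] when [S] and [X] are fractional ideals. *)
Definition sumprod (A : comNzRingType) (S X : set A) : set A :=
  [set z | exists2 s : seq (A * A),
     (forall p, p \in s -> S p.1 /\ X p.2) & z = \sum_(p <- s) p.1 * p.2].

Definition setsum (V : nmodType) (A B : set V) : set V :=
  [set a + b | a in A & b in B].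

Section Dedekind.
Variable R : idomainType.

Definition is_ideal (I : set R) : Prop :=
  I 0 /\ forall a u v, I u -> I v -> I (a * u + v).

Definition prime_ideal (P : set R) : Prop :=
  [/\ is_ideal P, ~ P 1 & forall u v, P (u * v) -> P u \/ P v].

Definition noetherian : Prop :=
  forall I, is_ideal I -> exists s : seq R, I = sumprod setT [set` s].

Definition integrally_closed : Prop :=
  forall z : {fraction R}, integralOver (@tofrac R) z -> range (@tofrac R) z.

Definition has_prime_chain (k : nat) : Prop :=
  exists P : 'I_k.+1 -> set R,
    (forall i, prime_ideal (P i)) /\
    (forall i j : 'I_k.+1, (i < j)%N -> P i `<` P j).

Definition krull_dim_eq (d : nat) : Prop :=
  forall k, has_prime_chain k <-> (k <= d)%N.

Definition dedekind_domain : Prop :=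
  [/\ noetherian, integrally_closed & krull_dim_eq 1].

End Dedekind.

(* [le] is the non-strict relation. *)
Definition monomial_ordering (n : nat) (le : rel 'X_{1..n}) : Prop :=
  [/\ reflexive le, antisymmetric le, transitive le & total le] /\
  well_founded (fun m1 m2 => (m1 != m2) && le m1 m2) /\
  (forall m m1 m2, le m1 m2 -> le (m + m1)%MM (m + m2)%MM).

Section FractionalIdeals.
Variable R : idomainType.
Local Notation K := {fraction R}.

Definition Rimg : set K := range (@tofrac R).

Definition fractional_ideal (a : set K) : Prop :=
  (exists2 z, a z & z != 0) /\ (exists s : seq K, a = sumprod Rimg [set` s]).

Definition fideal_inv (a : set K) : set K :=
  [set z | forall u, a u -> Rimg (z * u)].

Definition poly_over (n : nat) (a : set K) : set {mpoly K[n]} :=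
  [set p | forall m, a p@_m].

End FractionalIdeals.
Arguments Rimg : clear implicits.

Section PseudoPolynomials.
Variables (R : idomainType) (n : nat).
Local Notation K := {fraction R}.

Definition ppoly : Type := ({mpoly K[n]} * set K)%type.

Definition pseudo_polynomial (p : ppoly) : Prop :=
  fractional_ideal p.2 /\ forall a, p.2 a -> poly_over (Rimg R) (a *: p.1).

Definition nonzero_ppoly (p : ppoly) : Prop :=
  pseudo_polynomial p /\ p.1 != 0.

Definition pp_span1 (p : ppoly) : set {mpoly K[n]} :=
  [set a * p.1 | a in poly_over p.2].

Definition pp_span (G : seq ppoly) : set {mpoly K[n]} :=
  \big[@setsum _/[set 0]]_(g <- G) pp_span1 g.

Variable le : rel 'X_{1..n}.
Implicit Types (f : {mpoly K[n]}) (p q h : ppoly) (G : seq ppoly).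

(* [msupp f] lists the exponents of [f]; for [f = 0] the value is junk. The
   library's [mlead] is tied to one fixed ordering. *)
Definition ldeg f : 'X_{1..n} := last 0%MM (sort le (msupp f)).
Definition lcoef f : K := f@_(ldeg f).
Definition lterm f : {mpoly K[n]} := lcoef f *: 'X_[ldeg f].

Definition lc_ideal p : set K := [set a * lcoef p.1 | a in p.2].

Definition Lt1 p : set {mpoly K[n]} :=
  [set a * lterm p.1 | a in poly_over p.2].

Definition Lt_fam G : set {mpoly K[n]} :=
  \big[@setsum _/[set 0]]_(g <- G) Lt1 g.

Definition Lt_ideal (I : set {mpoly K[n]}) : set {mpoly K[n]} :=
  sumprod (poly_over (Rimg R)) [set lterm f | f in I `\ 0].

Definition pseudo_groebner_basis G (I : set {mpoly K[n]}) : Prop :=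
  [/\ forall g, g \in G -> nonzero_ppoly g,
      pp_span G `<=` I
    & Lt_ideal I = Lt_fam G].

(* [<=] on exponents is componentwise, i.e. divisibility of monomials. *)
Definition reducible G p : Prop :=
  lc_ideal p `<=`
    \big[@setsum _/[set 0]]_(g <- G | (ldeg g.1 <= ldeg p.1)%MM) lc_ideal g.

Definition minimal G p : Prop := ~ reducible G p.

Definition one_step_reduction G p q : Prop :=
  p.1 != 0 /\
  exists a : 'I_(size G) -> K,
    let g i := tnth (in_tuple G) i in
    let J i := (ldeg (g i).1 <= ldeg p.1)%MM in
    [/\ forall i, J i -> sumprod (g i).2 (fideal_inv p.2) (a i),
        lcoef p.1 = \sum_(i | J i) a i * lcoef (g i).1
      & q = (p.1 - \sum_(i | J i)
                     a i *: ('X_[(ldeg p.1 - ldeg (g i).1)%MM] * (g i).1),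
             p.2)].

Definition reduces G : ppoly -> ppoly -> Prop :=
  clos_refl_trans ppoly (one_step_reduction G).

Definition spoly p q : ppoly :=
  let m := mlcm (ldeg p.1) (ldeg q.1) in
  ((lcoef p.1)^-1 *: ('X_[(m - ldeg p.1)%MM] * p.1)
     - (lcoef q.1)^-1 *: ('X_[(m - ldeg q.1)%MM] * q.1),
   lc_ideal p `&` lc_ideal q).

(* The pair (G~, G) of the procedure. *)
Definition bb_state : Type := (set (ppoly * ppoly) * seq ppoly)%type.

Definition bb_init (F : seq ppoly) : bb_state :=
  ([set pq | exists i j : 'I_(size F),
      (i < j)%N /\ pq = (tnth (in_tuple F) i, tnth (in_tuple F) j)],
   F).

(* One pass through the loop body, for any admissible choice. *)
Inductive bb_step : bb_state -> bb_state -> Prop :=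
| bb_step_zero Gt G p q h :
    Gt (p, q) -> reduces G (spoly p q) h -> h.1 = 0 ->
    bb_step (Gt, G) (Gt `\ (p, q), G)
| bb_step_new Gt G p q h :
    Gt (p, q) -> reduces G (spoly p q) h -> h.1 != 0 -> minimal G h ->
    bb_step (Gt, G)
            ((Gt `\ (p, q)) `|` [set (f, h) | f in [set` G]], rcons G h).

Definition bb_reachable (F : seq ppoly) : bb_state -> Prop :=
  clos_refl_trans bb_state bb_step (bb_init F).

End PseudoPolynomials.

(* Main.v *)
(**
Over a Dedekind domain fractional ideals are invertible, so their lattice is
distributive, and this is all that separates the situation from the case of a
field. Distributivity shows that the syzygies between the ideals lc(g_i, g_i)
are generated by those of pairs; hence a representation of an element of <G>
whose top terms cancel can be rewritten, through the S-polynomials, with a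
smaller top exponent, and one of least top exponent exhibits the leading term
as an element of Lt(G). Invertibility also turns reducibility into an actual
reduction step. The procedure terminates because, by Dickson's lemma, an
infinite run would yield remainders with exponents increasing for divisibility
whose leading coefficient ideals contradict the ascending chain condition in R.

Invertibility: for a in a prime M, a colon ideal (aR : b) maximal among those
inside M is prime, hence equals M in dimension one if a is non-zero; then b/a
is not in R but multiplies M into R. If N N^-1 were inside M, then b/a would
stabilize N^-1 and be integral over R.
*)

Require Import Defs.
From HB Require Import structures.
From mathcomp Require Import all_boot all_order all_algebra.
From mathcomp Require Import boolp classical_sets.
From mathcomp Require Import mpoly.
From Stdlib Require Import Relation_Operators.
Set Implicit Arguments.
Unset Strict Implicit.
Unset Printing Implicit Defensive.
Import GRing.Theory.
Local Open Scope ring_scope.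
Local Open Scope classical_set_scope.

(** * Noetherian domains: chains, prime ideals and colon ideals *)

Section Ideals.
Variable R : idomainType.
Implicit Types (I J M P : set R) (a b u v r : R).

Lemma ideal_add I u v : is_ideal I -> I u -> I v -> I (u + v).
Proof. by move=> [_ hI] Iu Iv; rewrite -[u]mul1r; apply: hI. Qed.

Lemma ideal_mul I a u : is_ideal I -> I u -> I (a * u).
Proof. by move=> [I0 hI] Iu; rewrite -[a * u]addr0; apply: hI. Qed.

Lemma ideal_span I (s : seq R) :
  is_ideal I -> (forall x, x \in s -> I x) -> sumprod setT [set` s] `<=` I.
Proof.
move=> hI sI _ [t ht ->]; rewrite big_seq.
elim/big_ind: _ => [|u v|p pt]; first by case: hI.
- exact: ideal_add.
- by apply: ideal_mul => //; apply: sI; have [] := ht p pt.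
Qed.

(** The union of the chain is an ideal, and its finitely many generators already lie in a single
    term. *)
Lemma noetherian_chain (I : nat -> set R) :
  noetherian R -> (forall k, is_ideal (I k)) ->
  (forall k, I k `<=` I k.+1) -> exists N, I N.+1 `<=` I N.
Proof.
move=> hR hI Iinc.
have Imono k l : (k <= l)%N -> I k `<=` I l.
  elim: l => [|l ih]; first by rewrite leqn0 => /eqP ->.
  rewrite leq_eqVlt => /predU1P[-> //|/ih kl]; exact: subset_trans kl _.
pose U := [set r | exists k, I k r].
have hU : is_ideal U.
  split=> [|a u v [k Iku] [l Ilv]]; first by exists 0%N; case: (hI 0%N).
  exists (maxn k l); case: (hI (maxn k l)) => _; apply.
    exact: Imono (leq_maxl _ _) _ Iku.
  exact: Imono (leq_maxr _ _) _ Ilv.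
have [s Us] := hR U hU.
have sU x : x \in s -> U x.
  move=> xs; rewrite Us; exists [:: (1, x)]; last by rewrite big_seq1 mul1r.
  by move=> p; rewrite inE => /eqP ->.
have [N hN] : exists N, forall x, x \in s -> I N x.
  elim: s sU {Us} => [|x s ih] sU; first by exists 0%N.
  have [k Ik] : U x by apply: sU; rewrite mem_head.
  have [l Il] : exists N, forall x, x \in s -> I N x.
    by apply: ih => y ys; apply: sU; rewrite inE ys orbT.
  exists (maxn k l) => y; rewrite inE => /predU1P[->|/Il].
    exact: Imono (leq_maxl _ _) _ Ik.
  exact: Imono (leq_maxr _ _) _.
exists N => r INr; have : U r by exists N.+1.
by rewrite Us; apply: ideal_span.
Qed.

Lemma noetherian_maximal (S : set (set R)) :
  noetherian R -> (forall I, S I -> is_ideal I) -> S !=set0 ->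
  exists2 M, S M & forall I, S I -> M `<=` I -> I `<=` M.
Proof.
move=> hR hS [I0 SI0]; apply: contrapT => nomax.
have next (I : {I | S I}) : exists J : {J | S J},
    sval I `<=` sval J /\ ~ sval J `<=` sval I.
  apply: contrapT => noJ; apply: nomax; exists (sval I); first exact: svalP.
  move=> J SJ IJ; apply: contrapT => nJI.
  by apply: noJ; exists (exist _ J SJ).
have [f hf] := choice next.
pose C k := sval (iter k f (exist _ I0 SI0)).
have [N] : exists N, C N.+1 `<=` C N.
  apply: noetherian_chain => // k; first by apply: hS; apply: svalP.
  by have [] := hf (iter k f (exist _ I0 SI0)).
by have [] := hf (iter N f (exist _ I0 SI0)).
Qed.

(** [M] is maximal among the proper ideals above [J]: if [u] is outside [M], then [1 = m + a u] with
    [m] in [M], so [v = m v + a u v] lies in [M]. *)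
Lemma exists_prime_above J : noetherian R -> is_ideal J -> ~ J 1 ->
  exists2 M, prime_ideal M & J `<=` M.
Proof.
move=> hR hJ J1.
have [||M [hM M1 JM] Mmax] :=
  @noetherian_maximal [set I | [/\ is_ideal I, ~ I 1 & J `<=` I]] hR.
- by move=> I [].
- by exists J; split.
exists M => //; split=> // u v Muv; have [Mu|nMu] := pselect (M u); [by left|right].
pose I := [set x | exists2 m, M m & exists a, x = m + a * u].
have MI : M `<=` I by move=> m Mm; exists m => //; exists 0; rewrite mul0r addr0.
have hI : is_ideal I.
  split=> [|a _ _ [m Mm [b ->]] [m' Mm' [b' ->]]]; first by apply: MI; case: hM.
  exists (a * m + m'); first by case: hM => _; apply.
  by exists (a * b + b'); rewrite mulrDr mulrDl !mulrA addrACA.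
have [[m Mm [a e]]|nI1] := pselect (I 1).
  rewrite -[v]mulr1 e mulrDr mulrCA [v * u]mulrC.
  by apply: ideal_add => //; apply: ideal_mul.
case: nMu; apply: (Mmax I) => //; first by split=> //; apply: subset_trans JM MI.
exists 0; first by case: hM.
by exists 1; rewrite mul1r add0r.
Qed.

(** The ideal quotient (aR : b). *)
Definition colon a b : set R := [set r | exists c, r * b = c * a].

Lemma colon_ideal a b : is_ideal (colon a b).
Proof.
split=> [|r u v [c hc] [d hd]]; first by exists 0; rewrite !mul0r.
by exists (r * c + d); rewrite !mulrDl -!mulrA hc hd.
Qed.

Lemma exists_colon_prime a M : noetherian R -> prime_ideal M -> M a ->
  exists2 b, prime_ideal (colon a b) & colon a b `<=` M.
Proof.
move=> hR [hM M1 Mp] Ma.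
have [||_ [[b ->] bM] bmax] := @noetherian_maximal
  [set I | (exists b, I = colon a b) /\ I `<=` M] hR.
- by move=> _ [[b ->] _]; apply: colon_ideal.
- exists (colon a 1); split; first by exists 1.
  by move=> r [c]; rewrite mulr1 => ->; apply: ideal_mul.
exists b => //; split; [exact: colon_ideal|by move=> /bM|move=> x y [c xy]].
have maxb d : (forall r, colon a b r -> colon a (d * b) r) ->
    colon a (d * b) `<=` M -> colon a (d * b) `<=` colon a b.
  by move=> h1 h2; apply: bmax => //; split=> //; exists (d * b).
have colonM d r : colon a b r -> colon a (d * b) r.
  by move=> [e re]; exists (d * e); rewrite mulrCA re mulrA.
(* If (aR : yb) stays inside [M], it equals (aR : b) by maximality, and it contains [x]. Otherwise
   some [s] outside [M] has [s y b] in aR; primality of [M] keeps (aR : sb) inside [M], so it equals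
   (aR : b), and it contains [y]. *)
have [h|] := pselect (colon a (y * b) `<=` M).
  by left; apply: maxb h _ _; [apply: colonM|exists c; rewrite mulrA].
move=> /existsNP[s /not_implyP[[d sd] nMs]]; right.
apply: (maxb s (colonM s)); last by exists d; rewrite -sd !mulrA [y * s]mulrC.
move=> r [e re]; have [|//|] := Mp s r; last by [].
by apply: bM; exists e; rewrite -re mulrCA mulrA.
Qed.

Lemma dim1_prime_maximal P M : krull_dim_eq R 1 ->
  prime_ideal P -> prime_ideal M -> P `<=` M -> (exists2 a, P a & a != 0) ->
  M `<=` P.
Proof.
move=> hdim pP pM PM [a Pa a0]; apply: contrapT => nMP.
suff /hdim : has_prime_chain R 2 by [].
have p0 : prime_ideal [set (0 : R)].
  split=> [||u v /= /eqP]; last 1 first.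
  - by rewrite mulf_eq0 => /orP[] /eqP ->; [left|right].
  - by split=> // r u v /= -> ->; rewrite mulr0 addr0.
  - by move=> /= /eqP; rewrite oner_eq0.
have P0 : [set (0 : R)] `<=` P by move=> _ ->; case: pP => [[]].
have M0 : [set (0 : R)] `<=` M by move=> _ ->; case: pM => [[]].
have nP0 : ~ P `<=` [set 0] by move=> /(_ a Pa) /= /eqP; apply/negP.
exists (fun i : 'I_3 => nth setT [:: [set 0]; P; M] i); split.
  by case=> [[|[|[|]]]].
case=> [[|[|[|//]]]] ?; case=> [[|[|[|//]]]] ? //= _; split=> //.
by move=> /(subset_trans PM).
Qed.

End Ideals.

(** * Invertibility of fractional ideals *)

Section FractionalIdealTheory.
Variable R : idomainType.
Local Notation K := {fraction R}.
Local Notation tofrac := (@FracField.tofrac R).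
Local Notation "x %:F" := (tofrac x).
Implicit Types (N S T : set K) (z : K).

(** Neither finite generation nor a non-zero element is demanded, so that sums, intersections and
    inverses can be handled before they are known to be fractional ideals. *)
Definition Rsubmod N : Prop :=
  N 0 /\ forall (r : R) u v, N u -> N v -> N (r%:F * u + v).

Lemma Rsubmod_add N u v : Rsubmod N -> N u -> N v -> N (u + v).
Proof. by move=> [_ hN] Nu Nv; rewrite -[u]mul1r -tofrac1; apply: hN. Qed.

Lemma Rsubmod_mul N r u : Rsubmod N -> Rimg R r -> N u -> N (r * u).
Proof. by move=> [N0 hN] [a _ <-] Nu; rewrite -[_ * u]addr0; apply: hN. Qed.

Lemma Rsubmod_opp N u : Rsubmod N -> N u -> N (- u).
Proof.
move=> hN Nu; rewrite -mulN1r; apply: Rsubmod_mul => //.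
by exists (-1) => //; rewrite tofracN tofrac1.
Qed.

Lemma Rsubmod_sum N (I : Type) (s : seq I) (P : pred I) (F : I -> K) :
  Rsubmod N -> (forall i, P i -> N (F i)) -> N (\sum_(i <- s | P i) F i).
Proof.
move=> hN hF; elim/big_ind: _ => //; first by case: hN.
by move=> u v; apply: Rsubmod_add.
Qed.

Lemma Rimg_submod : Rsubmod (Rimg R).
Proof.
split=> [|r _ _ [u _ <-] [v _ <-]]; first by exists 0; rewrite ?tofrac0.
by exists (r * u + v); rewrite // tofracD tofracM.
Qed.

Lemma Rimg1 : Rimg R 1. Proof. by exists 1; rewrite ?tofrac1. Qed.

Lemma mem_sumprod S T u v : S u -> T v -> sumprod S T (u * v).
Proof.
move=> Su Tv; exists [:: (u, v)]; last by rewrite big_seq1.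
by move=> p; rewrite inE => /eqP ->.
Qed.

Lemma sumprod_submod S T : Rsubmod S -> Rsubmod (sumprod S T).
Proof.
move=> hS; split=> [|r _ _ [s hs ->] [t ht ->]].
  by exists [::] => //; rewrite big_nil.
exists ([seq (r%:F * p.1, p.2) | p <- s] ++ t).
  move=> p; rewrite mem_cat => /orP[/mapP[q /hs[Sq Tq] ->]|/ht //].
  by split=> //; apply: Rsubmod_mul => //; exists r.
rewrite big_cat big_map /= mulr_sumr; congr (_ + _).
by apply: eq_bigr => q _; rewrite mulrA.
Qed.

Lemma sumprod_min S T N : Rsubmod N -> (forall u v, S u -> T v -> N (u * v)) ->
  sumprod S T `<=` N.
Proof.
move=> hN h _ [s hs ->]; rewrite big_seq; apply: Rsubmod_sum => // p /hs [].
exact: h.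
Qed.

Lemma fracP z : exists a b : R, b != 0 /\ b%:F * z = a%:F.
Proof.
elim/quotW: z => x; exists (\n_x)%R, (\d_x)%R; split; first exact: denom_ratioP.
rewrite mulrC; unlock FracField.tofrac.
rewrite -[LHS]FracField.pi_mul; apply/eqmodP => /=.
have dx := denom_ratioP x.
rewrite FracField.equivfE /FracField.mulf !numden_Ratio ?oner_neq0 ?mulr1 //.
by rewrite mulrC.
Qed.

Lemma fractional_submod N : fractional_ideal N -> Rsubmod N.
Proof. by move=> [_ [s ->]]; apply: sumprod_submod; apply: Rimg_submod. Qed.

Lemma fractional_denom N : fractional_ideal N ->
  exists2 d : R, d != 0 & forall u, N u -> Rimg R (d%:F * u).
Proof.
move=> [_ [s ->]].
have [d d0 hd] : exists2 d : R, d != 0 & forall u, u \in s -> Rimg R (d%:F * u).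
  elim: s => [|x s [d d0 hd]]; first by exists 1; rewrite ?oner_neq0.
  have [a [b [b0 bx]]] := fracP x.
  exists (d * b) => [|u]; first by rewrite mulf_neq0.
  rewrite inE tofracM => /predU1P[->|/hd du].
    by rewrite -mulrA bx -tofracM; exists (d * a).
  rewrite [_ * b%:F]mulrC -mulrA; apply: Rsubmod_mul => //; first exact: Rimg_submod.
  by exists b.
exists d => // _ [t ht ->]; rewrite mulr_sumr big_seq.
apply: Rsubmod_sum; first exact: Rimg_submod.
move=> p /ht[p1 /= p2]; rewrite mulrCA; apply: Rsubmod_mul => //.
  exact: Rimg_submod.
exact: hd.
Qed.

(** Multiplication by [d] carries [N] onto an ideal of [R]; finitely many generators of that ideal,
    divided by [d], generate [N]. *)
Lemma fractional_intro N (d : R) : noetherian R -> Rsubmod N ->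
  (exists2 z, N z & z != 0) -> d != 0 -> (forall u, N u -> Rimg R (d%:F * u)) ->
  fractional_ideal N.
Proof.
move=> hR hN nz d0 hd; split=> //.
have dF0 : d%:F != 0 by rewrite tofrac_eq0.
pose I := [set r : R | N (r%:F / d%:F)].
have hI : is_ideal I.
  split=> [|a u v Iu Iv]; first by rewrite /I /= tofrac0 mul0r; case: hN.
  rewrite /I /= tofracD tofracM mulrDl -mulrA; case: hN => _; exact.
have [s Is] := hR I hI; exists [seq x%:F / d%:F | x <- s].
apply/seteqP; split=> [u Nu|].
  have [r _ ru] := hd u Nu.
  have eu : u = r%:F / d%:F by rewrite ru mulrC mulKf.
  have : I r by rewrite /I /= -eu.
  rewrite eu Is => -[t ht ->].
  exists [seq (p.1%:F, p.2%:F / d%:F) | p <- t].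
    move=> _ /mapP[p /ht[_ ps] ->]; split; first by exists p.1.
    by apply/mapP; exists p.2.
  rewrite big_map raddf_sum mulr_suml; apply: eq_bigr => p _ /=.
  by rewrite tofracM mulrA.
apply: sumprod_min => // u _ ru /mapP[x xs ->]; apply: Rsubmod_mul => //.
rewrite -[N _]/(I x) Is -[x]mul1r; exists [:: (1, x)]; last by rewrite big_seq1.
by move=> p; rewrite inE => /eqP ->.
Qed.

Lemma fideal_inv_submod N : Rsubmod (fideal_inv N).
Proof.
have hR := Rimg_submod.
split=> [u _|r u v hu hv x Nx]; first by rewrite mul0r; case: hR.
rewrite mulrDl -mulrA; case: hR => _ h; apply: h; [exact: hu|exact: hv].
Qed.

(** A common denominator of [N] is a non-zero element of the inverse; a numerator [a] of a non-zero
    [u] in [N] is a common denominator of the inverse. *)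
Lemma fideal_inv_fractional N :
  noetherian R -> fractional_ideal N -> fractional_ideal (fideal_inv N).
Proof.
move=> hR hN; have [[u Nu u0] _] := hN.
have [d d0 hd] := fractional_denom hN.
have [a [b [b0 bu]]] := fracP u.
have a0 : a != 0 by rewrite -tofrac_eq0 -bu mulf_neq0 // tofrac_eq0.
apply: (@fractional_intro _ a) => //; first exact: fideal_inv_submod.
  by exists d%:F; rewrite ?tofrac_eq0.
move=> v hv; rewrite -bu -mulrA; apply: Rsubmod_mul; first exact: Rimg_submod.
  by exists b.
by rewrite mulrC; apply: hv.
Qed.

Lemma sumprod_seq_coord (s : seq K) u : sumprod (Rimg R) [set` s] u ->
  exists c : 'I_(size s) -> R, u = \sum_j (c j)%:F * s`_j.
Proof.
move=> [t]; elim: t u => [|p t ih] u ht ->.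
  by exists (fun=> 0); rewrite big_nil big1 // => j _; rewrite tofrac0 mul0r.
have [|c hc] := ih _ _ erefl; first by move=> q qt; apply: ht; rewrite inE qt orbT.
have [[r _ rp] /= ps] := ht p (mem_head _ _).
rewrite big_cons hc.
have hi : (index p.2 s < size s)%N by rewrite index_mem.
(* A generator may be repeated in [s]; the coefficient is credited to its first position. *)
exists (fun j => (if j == Ordinal hi then r else 0) + c j).
under [RHS]eq_bigr do rewrite tofracD mulrDl.
rewrite big_split /=; congr (_ + _).
rewrite (bigD1 (Ordinal hi)) //= eqxx rp nth_index // big1 ?addr0 // => j /negPf ->.
by rewrite tofrac0 mul0r.
Qed.

(** The determinant trick: [z] acts on the generators of [N] through a matrix over [R], so it is a
    root of the characteristic polynomial. *)
Lemma stable_integral N z : fractional_ideal N ->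
  (forall u, N u -> N (z * u)) -> integralOver tofrac z.
Proof.
move=> [[x Nx x0] [s Ns]] hz.
have sN i : (i < size s)%N -> N s`_i.
  move=> si; rewrite Ns -[s`_i]mul1r; apply: mem_sumprod; first exact: Rimg1.
  exact: mem_nth.
have /choice[c hc] (i : 'I_(size s)) : exists c : 'I_(size s) -> R,
    z * s`_i = \sum_j (c j)%:F * s`_j.
  by apply: sumprod_seq_coord; rewrite -Ns; apply/hz/sN.
(* Transposed, because the eigenvectors are row vectors. *)
pose A : 'M[R]_(size s) := \matrix_(j, i) c i j.
exists (char_poly A); first exact: char_poly_monic.
rewrite map_char_poly -eigenvalue_root_char; apply/eigenvalueP.
exists (\row_i s`_i).
  apply/rowP => i; rewrite !mxE hc; apply: eq_bigr => j _.
  by rewrite !mxE mulrC.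
apply: contraNneq x0 => s0; move: Nx; rewrite Ns => /sumprod_seq_coord[d ->].
rewrite big1 // => j _; move/rowP/(_ j): s0; rewrite !mxE => ->.
by rewrite mulr0.
Qed.

Lemma exists_nonintegral_colon (J : set R) (a : R) : dedekind_domain R ->
  is_ideal J -> ~ J 1 -> J a -> a != 0 ->
  exists2 z, ~ Rimg R z & forall r, J r -> Rimg R (z * r%:F).
Proof.
move=> [hR _ hdim] hJ J1 Ja a0.
have [M pM JM] := exists_prime_above hR hJ J1.
have [b pb bM] := exists_colon_prime hR pM (JM a Ja).
have aF0 : a%:F != 0 by rewrite tofrac_eq0.
have Mb : M `<=` colon a b.
  apply: dim1_prime_maximal => //; exists a => //.
  by exists b; rewrite mulrC.
(* If [b / a] were in [R], the prime (aR : b) would contain 1. *)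
exists (b%:F / a%:F) => [[c _ e]|r /JM/Mb[c hc]].
  case: pb => _ b1 _; apply: b1; exists c.
  by rewrite mul1r; apply/eqP; rewrite -tofrac_eq tofracM e divfK.
by exists c; rewrite // mulrAC -tofracM [b * r]mulrC hc tofracM mulfK.
Qed.

(* If [J := N N^-1] were proper, then [z] with [z J] inside [R] and [z] not in
   [R] would map [N^-1] into itself, hence be integral. *)
Lemma fractional_invertible N : dedekind_domain R -> fractional_ideal N ->
  sumprod N (fideal_inv N) 1.
Proof.
move=> hD hN; have [hR hint _] := hD.
have sN := fractional_submod hN.
have hV := fideal_inv_fractional hR hN.
have sV := fractional_submod hV.
have sNV : Rsubmod (sumprod N (fideal_inv N)) by apply: sumprod_submod.
pose J := [set r : R | sumprod N (fideal_inv N) r%:F].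
apply: contrapT => n1.
have hJ : is_ideal J.
  split=> [|a u v Ju Jv]; rewrite /J /=; first by rewrite tofrac0; case: sNV.
  by rewrite tofracD tofracM; case: sNV => _; apply.
have [[u Nu u0] _] := hN; have [[v Vv v0] _] := hV.
have [r _ er] := Vv u Nu.
have [|||z nz hz] := @exists_nonintegral_colon J r hD hJ.
- by rewrite /J /= tofrac1.
- by rewrite /J /= er mulrC; apply: mem_sumprod.
- by rewrite -tofrac_eq0 er mulf_neq0.
apply/nz/hint; apply: stable_integral hV _ => w Vw x Nx.
have [e _ ee] := Vw x Nx; rewrite -mulrA -ee; apply: hz.
by rewrite /J /= ee mulrC; apply: mem_sumprod.
Qed.

End FractionalIdealTheory.

(** * Finite sums of sets *)

Section BigSetsum.
Variable V : nmodType.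

(** The components form a function of the index, so a repeated index could carry only one of them;
    hence [uniq s]. *)
Lemma big_setsum_coord (I : eqType) (s : seq I) (P : pred I) (X : I -> set V) z :
  uniq s -> (\big[@setsum V/[set 0]]_(i <- s | P i) X i) z ->
  exists2 b : I -> V, forall i, P i -> i \in s -> X i (b i)
                    & z = \sum_(i <- s | P i) b i.
Proof.
elim: s z => [|i s ih] z /=.
  by rewrite big_nil => _ ->; exists (fun=> 0) => //; rewrite big_nil.
move=> /andP[nis us]; rewrite big_cons; case: ifP => Pi; last first.
  move=> /(ih _ us)[b hb ->]; exists b; last by rewrite big_cons Pi.
  by move=> j Pj; rewrite inE => /predU1P[ji|js]; [rewrite -ji Pj in Pi|apply: hb].
move=> [x Xx [y /(ih _ us)[b hb ->] <-]].
exists (fun j => if j == i then x else b j).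
  move=> j Pj; rewrite inE; case: (eqVneq j i) => [-> //|_] /= js.
  exact: hb.
rewrite big_cons Pi eqxx; congr (_ + _).
rewrite [LHS]big_seq_cond [RHS]big_seq_cond; apply: eq_bigr => j /andP[js _].
by case: eqVneq => // ji; rewrite -ji js in nis.
Qed.

Variables (I : eqType) (P : pred I) (X : I -> set V).
Implicit Type s : seq I.

Lemma big_setsum_min s (N : set V) : N 0 ->
  (forall u v, N u -> N v -> N (u + v)) ->
  (forall i, i \in s -> P i -> X i `<=` N) ->
  \big[@setsum V/[set 0]]_(i <- s | P i) X i `<=` N.
Proof.
move=> N0 ND hX; rewrite big_seq_cond; elim/big_ind: _.
- by move=> _ ->.
- by move=> A B hA hB _ [a Aa [b Bb <-]]; apply: ND; [apply: hA|apply: hB].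
- by move=> i /andP[] /hX; apply.
Qed.

Lemma big_setsum0 s : (forall i, i \in s -> X i 0) ->
  (\big[@setsum V/[set 0]]_(i <- s | P i) X i) 0.
Proof.
move=> h; rewrite big_seq_cond; elim/big_ind: _ => //; last by move=> i /andP[/h].
by move=> A B A0 B0; exists 0 => //; exists 0; rewrite ?addr0.
Qed.

Lemma mem_big_setsum s i : (forall i, i \in s -> X i 0) -> i \in s -> P i ->
  X i `<=` \big[@setsum V/[set 0]]_(i <- s | P i) X i.
Proof.
elim: s => [|j s ih] // X0; rewrite big_cons => hi Pi x Xx.
have X0s k : k \in s -> X k 0 by move=> ks; apply: X0; rewrite inE ks orbT.
move: hi; rewrite inE => /predU1P[ij|si].
  rewrite -ij Pi; exists x => //; exists 0; last by rewrite addr0.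
  exact: big_setsum0.
case: ifP => Pj; last exact: ih.
exists 0; first by apply: X0; rewrite mem_head.
by exists x; [apply: ih|rewrite add0r].
Qed.

Lemma big_setsum_add s :
  (forall i, i \in s -> forall u v, X i u -> X i v -> X i (u + v)) ->
  forall u v, (\big[@setsum V/[set 0]]_(i <- s | P i) X i) u ->
    (\big[@setsum V/[set 0]]_(i <- s | P i) X i) v ->
    (\big[@setsum V/[set 0]]_(i <- s | P i) X i) (u + v).
Proof.
rewrite big_seq_cond => h; elim/big_ind: _ => [_ _ -> ->|A B hA hB|i /andP[/h hi _]].
- by rewrite /= addr0.
- move=> _ _ [a Aa [b Bb <-]] [c Ac [d Bd <-]]; rewrite addrACA.
  by exists (a + c); [apply: hA|exists (b + d); first exact: hB].
- exact: hi.
Qed.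

Lemma big_setsum_stable s (f : V -> V) : f 0 = 0 ->
  (forall u v, f (u + v) = f u + f v) ->
  (forall i, i \in s -> forall u, X i u -> X i (f u)) ->
  forall u, (\big[@setsum V/[set 0]]_(i <- s | P i) X i) u ->
    (\big[@setsum V/[set 0]]_(i <- s | P i) X i) (f u).
Proof.
move=> f0 fD; rewrite big_seq_cond => h.
elim/big_ind: _ => [_ ->|A B hA hB|i /andP[/h hi _]].
- by rewrite /= f0.
- move=> _ [a Aa [b Bb <-]]; rewrite fD.
  by exists (f a); [apply: hA|exists (f b); first exact: hB].
- exact: hi.
Qed.

End BigSetsum.

(** * Supports and leading terms *)

Section Supports.
Variables (K : fieldType) (n : nat).
Implicit Types (f g : {mpoly K[n]}) (P Q : pred 'X_{1..n}) (a b m : 'X_{1..n}).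

(** Bounds are put on the support rather than on [ldeg], so that they hold for 0, whose leading
    exponent is junk. *)
Definition supp_in P f : Prop := forall a, f@_a != 0 -> P a.

Lemma supp_in0 P : supp_in P 0.
Proof. by move=> a; rewrite mcoeff0 eqxx. Qed.

Lemma supp_in_add P f g : supp_in P f -> supp_in P g -> supp_in P (f + g).
Proof.
move=> hf hg a; have [f0|/hf //] := eqVneq (f@_a) 0.
by rewrite mcoeffD f0 add0r => /hg.
Qed.

Lemma supp_in_scale P c f : supp_in P f -> supp_in P (c *: f).
Proof. by move=> hf a; rewrite mcoeffZ mulf_eq0 negb_or => /andP[_ /hf]. Qed.

Lemma supp_in_sub P f g : supp_in P f -> supp_in P g -> supp_in P (f - g).
Proof.
by move=> hf hg; apply: supp_in_add => //; rewrite -scaleN1r; apply: supp_in_scale.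
Qed.

Lemma supp_in_sum P (I : Type) (s : seq I) (Q : pred I) (F : I -> {mpoly K[n]}) :
  (forall i, Q i -> supp_in P (F i)) -> supp_in P (\sum_(i <- s | Q i) F i).
Proof.
move=> h; elim/big_ind: _ => //; first exact: supp_in0.
by move=> ? ?; apply: supp_in_add.
Qed.

Lemma mcoeffXM m k f : ('X_[m] * f)@_(m + k) = f@_k.
Proof. by rewrite mulrC mcoeffMX. Qed.

Lemma supp_in_XM P Q m f : (forall a, P a -> Q (m + a)%MM) -> supp_in P f ->
  supp_in Q ('X_[m] * f).
Proof.
move=> PQ hf a; rewrite -mcoeff_msupp mulrC (perm_mem (msuppMX _ _)).
by move=> /mapP[k kf ->]; apply/PQ/hf; rewrite -mcoeff_msupp.
Qed.

End Supports.

Section LeadingTerms.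
Variables (R : idomainType) (n : nat) (le : rel 'X_{1..n}).
Local Notation K := {fraction R}.
Hypothesis hle : monomial_ordering le.
Implicit Types (f g : {mpoly K[n]}) (a b m : 'X_{1..n}).

Definition mlt : rel 'X_{1..n} := [rel a b | (a != b) && le a b].

Lemma mle_refl m : le m m. Proof. by case: hle => [[]]. Qed.

Lemma mle_trans b a c : le a b -> le b c -> le a c.
Proof. by case: hle => [[_ _ h _] _]; apply: h. Qed.

Lemma mle_anti a b : le a b -> le b a -> a = b.
Proof. by case: hle => [[_ h _ _] _] ab ba; apply: h; rewrite ab ba. Qed.

Lemma mle_total a b : le a b || le b a. Proof. by case: hle => [[]]. Qed.

Lemma mle_add m a b : le a b -> le (m + a)%MM (m + b)%MM.
Proof. by case: hle => [_ [_ h]]; apply: h. Qed.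

Lemma mltW a b : mlt a b -> le a b. Proof. by case/andP. Qed.

Lemma mlt_add m a b : mlt a b -> mlt (m + a)%MM (m + b)%MM.
Proof. by case/andP => ab h; rewrite /mlt /= eqm_add2l ab mle_add. Qed.

Lemma mle_lt_trans b a c : le a b -> mlt b c -> mlt a c.
Proof.
move=> ab /andP[bc hbc]; rewrite /mlt /= (mle_trans ab hbc) andbT.
by apply: contraNneq bc => ac; rewrite ac in ab; rewrite (mle_anti ab hbc).
Qed.

Lemma mlt_wf : well_founded mlt.
Proof. by case: hle => [_ []]. Qed.

Lemma mle_minimal (S : set 'X_{1..n}) : S !=set0 ->
  exists2 m, S m & forall a, mlt a m -> ~ S a.
Proof.
move=> [m0 Sm0]; apply: contrapT => nomin.
elim/(well_founded_ind mlt_wf): m0 Sm0 => m ih Sm.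
by apply: nomin; exists m => // a am Sa; apply: ih am Sa.
Qed.

Lemma ldeg_msupp f : f != 0 -> ldeg le f \in msupp f.
Proof.
rewrite -msupp_eq0 /ldeg -(mem_sort le) -size_eq0 -(size_sort le) size_eq0.
by case: (sort le _) => // x s _; rewrite /= mem_last.
Qed.

Lemma lcoef_neq0 f : f != 0 -> lcoef le f != 0.
Proof. by move/ldeg_msupp; rewrite mcoeff_msupp. Qed.

Lemma le_ldeg f : supp_in (le^~ (ldeg le f)) f.
Proof.
move=> a; rewrite -mcoeff_msupp /ldeg -(mem_sort le).
have [[rle _ tle tot] _] := hle.
set s := sort le _; have ss : sorted le s by apply: sort_sorted.
move=> sa; rewrite -(nth_index 0%MM sa) -nth_last.
have ia : (index a s < size s)%N by rewrite index_mem.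
have s0 : (0 < size s)%N by apply: leq_ltn_trans ia.
apply: (sorted_leq_nth tle rle _ ss) => //; rewrite ?inE ?prednK //.
by rewrite -ltnS prednK.
Qed.

Lemma ldegP f m : f@_m != 0 -> supp_in (le^~ m) f -> ldeg le f = m.
Proof.
move=> fm hm; apply: mle_anti; last exact: le_ldeg.
apply: hm; apply: lcoef_neq0.
by apply: contraNneq fm => ->; rewrite mcoeff0.
Qed.

Lemma supp_in_mlt f m : supp_in (le^~ m) f -> f@_m = 0 -> supp_in (mlt^~ m) f.
Proof.
move=> hf fm a fa; rewrite /mlt /= hf // andbT.
by apply: contraNneq fa => ->; apply/eqP.
Qed.

Lemma supp_in_mlt_coef f m : supp_in (mlt^~ m) f -> f@_m = 0.
Proof.
by move=> h; apply/eqP; apply: contraT => /h; rewrite /mlt /= eqxx.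
Qed.

Lemma supp_in_ldeg (P : pred 'X_{1..n}) f : f != 0 -> supp_in P f -> P (ldeg le f).
Proof. by move=> f0; apply; apply: lcoef_neq0. Qed.

Lemma supp_in_shift m f : (ldeg le f <= m)%MM ->
  supp_in (le^~ m) ('X_[m - ldeg le f] * f).
Proof.
move=> fm; apply: supp_in_XM (@le_ldeg f) => a fa.
by rewrite -[X in le _ X](submK fm); apply: mle_add.
Qed.

Lemma mcoeff_shift m f : (ldeg le f <= m)%MM ->
  ('X_[m - ldeg le f] * f)@_m = lcoef le f.
Proof. by move=> fm; rewrite -[X in _@_X](submK fm) mcoeffXM. Qed.

Lemma ldeg_scaleXM c m f : c != 0 -> f != 0 ->
  ldeg le (c *: ('X_[m] * f)) = (m + ldeg le f)%MM.
Proof.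
move=> c0 f0; apply: ldegP.
  by rewrite mcoeffZ mcoeffXM mulf_neq0 // lcoef_neq0.
by apply/supp_in_scale/(supp_in_XM _ (@le_ldeg f)) => a; apply: mle_add.
Qed.

Lemma lterm_scaleXM c m f : c != 0 -> f != 0 ->
  lterm le (c *: ('X_[m] * f)) = c *: ('X_[m] * lterm le f).
Proof.
move=> c0 f0; rewrite /lterm /lcoef ldeg_scaleXM // mcoeffZ mcoeffXM mpolyXD.
by rewrite -scalerAr scalerA.
Qed.

End LeadingTerms.

(** * Standard representations and reduction *)

Section Combinations.
Variables (R : idomainType) (n : nat) (le : rel 'X_{1..n}).
Hypothesis hle : monomial_ordering le.
Local Notation K := {fraction R}.
Local Notation ppoly := (ppoly R n).
Implicit Types (f h : {mpoly K[n]}) (g p q : ppoly) (F G : seq ppoly).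
Implicit Types (P Q : pred 'X_{1..n}) (a b m : 'X_{1..n}).

(* [comb P G f] is a standard representation of [f]: [P] bounds the leading
   exponents of the summands [c x^b g], not the support of [f], where leading
   terms may have cancelled. *)
Inductive comb P G : {mpoly K[n]} -> Prop :=
| comb0 : comb P G 0
| comb_cons c b g f : g \in G -> g.2 c -> P (b + ldeg le g.1)%MM -> comb P G f ->
    comb P G (c *: ('X_[b] * g.1) + f).

Definition fractional_family G : Prop := forall g, g \in G -> fractional_ideal g.2.

Lemma comb1 P G c b g : g \in G -> g.2 c -> P (b + ldeg le g.1)%MM ->
  comb P G (c *: ('X_[b] * g.1)).
Proof.
by move=> *; rewrite -[_ *: _]addr0; apply: comb_cons => //; apply: comb0.
Qed.

Lemma comb_gen P G c g : g \in G -> g.2 c -> P (ldeg le g.1) ->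
  comb P G (c *: g.1).
Proof.
move=> gG gc Pg; rewrite -[g.1]mul1r -mpolyX0.
by apply: comb1 => //; rewrite add0m.
Qed.

Lemma comb_add P G f h : comb P G f -> comb P G h -> comb P G (f + h).
Proof.
move=> hf hh; elim: hf => [|c b g f' *]; first by rewrite add0r.
by rewrite -addrA; apply: comb_cons.
Qed.

Lemma comb_sum P G (I : Type) (s : seq I) (Q : pred I) (f : I -> {mpoly K[n]}) :
  (forall i, Q i -> comb P G (f i)) -> comb P G (\sum_(i <- s | Q i) f i).
Proof.
move=> h; elim/big_ind: _ => //; first exact: comb0.
by move=> ? ?; apply: comb_add.
Qed.

Lemma comb_opp P G f : fractional_family G -> comb P G f -> comb P G (- f).
Proof.
move=> hG; elim=> [|c b g f' gG gc Pb _ ih]; first by rewrite oppr0; apply: comb0.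
rewrite opprD -scaleNr; apply: comb_cons => //.
exact: Rsubmod_opp (fractional_submod (hG g gG)) _.
Qed.

Lemma comb_sub P G f h : fractional_family G ->
  comb P G f -> comb P G h -> comb P G (f - h).
Proof. by move=> hG hf hh; apply: comb_add => //; apply: comb_opp. Qed.

Lemma comb_mono P Q F G f : (forall m, P m -> Q m) -> {subset F <= G} ->
  comb P F f -> comb Q G f.
Proof.
move=> PQ FG; elim=> [|c b g f' gF gc Pb _ ih]; first exact: comb0.
by apply: comb_cons => //; [apply: FG|apply: PQ].
Qed.

Lemma comb_XM P Q G m f : (forall a, P a -> Q (m + a)%MM) ->
  comb P G f -> comb Q G ('X_[m] * f).
Proof.
move=> PQ; elim=> [|c b g f' gG gc Pb _ ih]; first by rewrite mulr0; apply: comb0.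
rewrite mulrDr -scalerAr mulrA -mpolyXD; apply: comb_cons => //.
by rewrite -addmA; apply: PQ.
Qed.

(** The bound [P] is lost: the expansions over [F] may have larger leading exponents that cancel. *)
Lemma comb_subst P G F f : comb P G f ->
  (forall g c, g \in G -> g.2 c -> comb predT F (c *: g.1)) -> comb predT F f.
Proof.
move=> hf h; elim: hf => [|c b g f' gG gc _ _ ih]; first exact: comb0.
apply: comb_add => //; rewrite scalerAr.
by apply: (@comb_XM predT) => //; apply: h.
Qed.

(** [P] is closed downwards because the lower terms of each summand also reach the support. *)
Lemma comb_supp (P : pred 'X_{1..n}) G f :
  (forall a b, le a b -> P b -> P a) -> comb P G f -> supp_in P f.
Proof.
move=> Ple; elim=> [|c b g f' _ _ Pb _ ih]; first exact: supp_in0.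
apply: supp_in_add => //; apply/supp_in_scale.
apply: (supp_in_XM _ (@le_ldeg _ _ _ hle g.1)) => a ag.
by apply: Ple Pb; apply: mle_add.
Qed.

(** [m] is the largest leading exponent among the summands, so it satisfies [P] itself; a strict
    bound thus becomes a smaller non-strict one. *)
Lemma comb_bound P G f : comb P G f ->
  f = 0 \/ exists2 m, P m & comb (le^~ m) G f.
Proof.
elim=> [|c b g f' gG gc Pb _ ih]; [by left|right].
set d := (b + ldeg le g.1)%MM in Pb.
have [->|[m Pm hm]] := ih.
  exists d; rewrite // addr0; apply: comb1 => //; exact: mle_refl.
have [dm|md] := orP (mle_total hle d m); [exists m|exists d] => //.
  exact: comb_cons.
apply: comb_cons => //; first exact: mle_refl.
by apply: comb_mono hm => // a am; apply: mle_trans am md.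
Qed.

Lemma poly_over_scaleX (S : set K) c m : S 0 -> S c -> poly_over S (c *: 'X_[m]).
Proof.
by move=> S0 Sc a; rewrite mcoeffZ mcoeffX; case: (m == a); rewrite ?mulr1 ?mulr0.
Qed.

Lemma poly_over_add (S : set K) f h : Rsubmod S -> poly_over S f ->
  poly_over S h -> poly_over S (f + h).
Proof. by move=> hS hf hh a; rewrite mcoeffD; apply: Rsubmod_add. Qed.

Lemma poly_over_mul (S : set K) f h : Rsubmod S -> poly_over (Rimg R) f ->
  poly_over S h -> poly_over S (f * h).
Proof.
move=> hS hf hh a; rewrite mcoeffM; apply: Rsubmod_sum => // k _.
exact: Rsubmod_mul.
Qed.

Lemma poly_overX m : poly_over (Rimg R) 'X_[m].
Proof.
rewrite -['X_[m]]scale1r; apply: poly_over_scaleX; last exact: Rimg1.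
by case: (Rimg_submod R).
Qed.

Lemma pp_spanP G f : fractional_family G -> pp_span G f <-> comb predT G f.
Proof.
move=> hG.
have sG g : g \in G -> Rsubmod g.2 by move=> /hG /fractional_submod.
split.
  apply: big_setsum_min; first exact: comb0.
    by move=> u v; apply: comb_add.
  move=> g gG _ _ [p hp <-]; rewrite [p]mpolyE mulr_suml.
  by apply: comb_sum => m _; rewrite -scalerAl; apply: comb1.
have s0 g : g \in G -> pp_span1 g 0.
  move=> gG; exists 0; rewrite ?mul0r // => a; rewrite mcoeff0.
  by case: (sG g gG).
elim=> [|c b g f' gG gc _ _ ih]; first by apply: big_setsum0.
apply: big_setsum_add => //.
  move=> i /sG hi _ _ [p hp <-] [p' hp' <-].
  by exists (p + p'); [apply: poly_over_add|rewrite mulrDl].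
apply: mem_big_setsum (gG) _ _ _ => //.
exists (c *: 'X_[b]); last by rewrite -scalerAl.
by apply: poly_over_scaleX => //; case: (sG g gG).
Qed.

Lemma comb_integral P G f : (forall g, g \in G -> pseudo_polynomial g) ->
  comb P G f -> poly_over (Rimg R) f.
Proof.
have hR := Rimg_submod R.
move=> hG; elim=> [|c b g f' gG gc _ _ ih]; first by move=> a; rewrite mcoeff0; case: hR.
apply: poly_over_add => //; rewrite scalerAr.
apply: poly_over_mul => //; first exact: poly_overX.
by have [_] := hG g gG; apply.
Qed.

Lemma lc_ideal_submod p : fractional_ideal p.2 -> Rsubmod (lc_ideal le p).
Proof.
move=> /fractional_submod[p0 hp]; split; first by exists 0; rewrite ?mul0r.
move=> r _ _ [u pu <-] [v pv <-].
by exists (FracField.tofrac r * u + v); [apply: hp|rewrite mulrDl mulrA].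
Qed.

Lemma lc_ideal_integral p : pseudo_polynomial p -> lc_ideal le p `<=` Rimg R.
Proof. by move=> [_ h] _ [c pc <-]; have := h c pc (ldeg le p.1); rewrite mcoeffZ. Qed.

Lemma lc_ideal_neq0 p : nonzero_ppoly p -> exists2 z, lc_ideal le p z & z != 0.
Proof.
move=> [[[[z pz z0] _] _] p0]; exists (z * lcoef le p.1); first by exists z.
by rewrite mulf_neq0 // lcoef_neq0.
Qed.

End Combinations.

Section Reduction.
Variables (R : idomainType) (n : nat) (le : rel 'X_{1..n}).
Hypothesis hle : monomial_ordering le.
Local Notation K := {fraction R}.
Local Notation ppoly := (ppoly R n).
Implicit Types (f : {mpoly K[n]}) (g h p q : ppoly) (G : seq ppoly) (m : 'X_{1..n}).

Lemma one_step_supp G p q : one_step_reduction le G p q ->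
  supp_in (mlt le ^~ (ldeg le p.1)) q.1.
Proof.
move=> [p0 [a /= [_ lca ->]]] /=; apply: supp_in_mlt.
  apply: supp_in_sub; first exact: le_ldeg.
  by apply: supp_in_sum => i Ji; apply/supp_in_scale/supp_in_shift.
rewrite mcoeffB raddf_sum /= -[p.1@_ _]/(lcoef le p.1) lca.
apply/eqP; rewrite subr_eq0; apply/eqP/eq_bigr => i Ji.
by rewrite mcoeffZ mcoeff_shift.
Qed.

(** Multiplying by [d] in [p.2] cancels the inverse ideal in which [a i] has a factor, so [d * a i]
    lies in the ideal of the i-th member. Each summand has leading exponent [ldeg le p.1], which is
    below [m]. *)
Lemma one_step_comb G p q m : fractional_family G ->
  one_step_reduction le G p q -> supp_in (mlt le ^~ m) p.1 ->
  [/\ q.2 = p.2, supp_in (mlt le ^~ m) q.1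
    & forall d, p.2 d -> comb le (mlt le ^~ m) G (d *: (p.1 - q.1))].
Proof.
move=> hG pq pm; have qp := one_step_supp pq.
case: pq => p0 [a /= [ha _ eq]]; have dp := supp_in_ldeg le p0 pm.
split; first by rewrite eq.
  move=> k /qp /mltW kp; exact: mle_lt_trans kp dp.
move=> d pd; rewrite eq /= opprB addrCA subrr addr0 scaler_sumr.
apply: comb_sum => i Ji; rewrite scalerA.
set g := tnth _ i in Ji *; have gG : g \in G by apply: mem_tnth.
apply: comb1 => //; last by rewrite submK.
have sg := fractional_submod (hG g gG).
have [t ht ->] := ha i Ji; rewrite mulr_sumr big_seq.
apply: Rsubmod_sum => // -[u v] /ht[/= gu vp].
by rewrite mulrCA mulrC; apply: Rsubmod_mul => //; rewrite mulrC; apply: vp.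
Qed.

Lemma reduces_comb G p q m : fractional_family G ->
  reduces le G p q -> supp_in (mlt le ^~ m) p.1 ->
  [/\ q.2 = p.2, supp_in (mlt le ^~ m) q.1
    & forall d, p.2 d -> comb le (mlt le ^~ m) G (d *: (p.1 - q.1))].
Proof.
move=> hG; elim=> [p' q'|p'|p' q' r _ ih1 _ ih2] hs.
- exact: one_step_comb.
- by split=> // d _; rewrite subrr scaler0; apply: comb0.
have [e1 s1 c1] := ih1 hs; have [e2 s2 c2] := ih2 s1.
split=> //; first by rewrite e2.
move=> d pd; rewrite -(subrK q'.1 p'.1) -addrA scalerDr.
by apply: comb_add; [apply: c1|apply: c2; rewrite e1].
Qed.

(** Write 1 as a sum of products [u v] with [u] in [p.2] and [v] in its inverse, expand each
    [u * lcoef le p.1] over the leading coefficients of [G], multiply by [v] and add up. *)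
Lemma reducible_one_step G p : dedekind_domain R -> fractional_family G ->
  fractional_ideal p.2 -> p.1 != 0 -> reducible le G p ->
  exists q, one_step_reduction le G p q.
Proof.
move=> hD hG hp p0 red.
have [t ht et] := fractional_invertible hD hp.
pose gi := tnth (in_tuple G); pose J i := (ldeg le (gi i).1 <= ldeg le p.1)%MM.
have /choice[b hb] (u : K) : exists b : 'I_(size G) -> K, p.2 u ->
    (forall i, J i -> (gi i).2 (b i)) /\
    u * lcoef le p.1 = \sum_(i | J i) b i * lcoef le (gi i).1.
  have [pu|npu] := pselect (p.2 u); last by exists (fun=> 0).
  have /red : lc_ideal le p (u * lcoef le p.1) by exists u.
  rewrite big_tnth => /big_setsum_coord[|c hc ec]; first exact: index_enum_uniq.
  have /choice[b hb] i : exists b, J i -> (gi i).2 b /\ b * lcoef le (gi i).1 = c i.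
    have [Ji|nJi] := boolP (J i); last by exists 0 => Ji; case/negP: nJi.
    by have [|b gb eb] := hc i Ji; [exact: mem_index_enum|exists b].
  exists b => _; split=> [i /hb[]//|].
  by rewrite ec; apply: eq_bigr => i /hb[].
eexists; split=> //; exists (fun i => \sum_(w <- t) b w.1 i * w.2) => /=.
split; last reflexivity.
  move=> i Ji; exists [seq (b w.1 i, w.2) | w <- t]; last by rewrite big_map.
  move=> _ /mapP[w /ht[pw vw] ->]; split=> //=.
  by have [+ _] := hb w.1 pw; apply.
rewrite -[LHS]mul1r et mulr_suml.
under [RHS]eq_bigr do rewrite mulr_suml.
rewrite exchange_big /= big_seq [RHS]big_seq; apply: eq_bigr => w /ht[pw _].
have [_ ew] := hb w.1 pw.
rewrite mulrAC ew mulr_suml; apply: eq_bigr => i _.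
by rewrite mulrAC.
Qed.

(** Each step strictly lowers the leading exponent, and the ordering is well-founded. *)
Lemma reduces_to_minimal G p : dedekind_domain R -> fractional_family G ->
  fractional_ideal p.2 ->
  exists2 h, reduces le G p h & h.1 = 0 \/ h.1 != 0 /\ minimal le G h.
Proof.
move=> hD hG; move: {2}(ldeg le p.1) (erefl (ldeg le p.1)) => m.
elim/(well_founded_ind (mlt_wf hle)): m p => m ih p pm hp.
have [p0|p0] := eqVneq p.1 0; first by exists p; [apply: rt_refl|left].
have [red|nred] := pselect (reducible le G p); last first.
  by exists p; [apply: rt_refl|right].
have [q pq] := reducible_one_step hD hG hp p0 red.
have qs := one_step_supp pq.
have [q0|q0] := eqVneq q.1 0; first by exists q; [apply: rt_step|left].
have eq2 : q.2 = p.2 by case: pq => _ [a [_ _ ->]].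
have [||h qh hh] := ih (ldeg le q.1) _ q erefl.
- by rewrite -pm; apply: (supp_in_ldeg le q0 qs).
- by rewrite eq2.
by exists h => //; apply: rt_trans (rt_step _ _ _ _ pq) qh.
Qed.

Lemma spoly_supp p q : p.1 != 0 -> q.1 != 0 ->
  supp_in (mlt le ^~ (mlcm (ldeg le p.1) (ldeg le q.1))) (spoly le p q).1.
Proof.
move=> p0 q0; have lp := lem_mlcml (ldeg le p.1) (ldeg le q.1).
have lq := lem_mlcmr (ldeg le p.1) (ldeg le q.1).
apply: supp_in_mlt; first by apply: supp_in_sub; apply/supp_in_scale/supp_in_shift.
by rewrite mcoeffB !mcoeffZ !mcoeff_shift // !mulVf ?lcoef_neq0 // subrr.
Qed.

(** [d] lies in both leading coefficient ideals, so dividing it by either leading coefficient leaves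
    an element of the corresponding ideal. *)
Lemma spoly_comb G p q d : fractional_family G -> p.1 != 0 -> q.1 != 0 ->
  p \in G -> q \in G -> (spoly le p q).2 d ->
  comb le predT G (d *: (spoly le p q).1).
Proof.
move=> hG p0 q0 pG qG [[u pu ud] [v qv vd]].
rewrite scalerBr !scalerA -{1}ud -vd !mulfK ?lcoef_neq0 //.
by apply: comb_sub => //; apply: comb1.
Qed.

Lemma spoly_fractional p q : noetherian R -> nonzero_ppoly p -> nonzero_ppoly q ->
  fractional_ideal (spoly le p q).2.
Proof.
move=> hR hp hq; have [z pz z0] := lc_ideal_neq0 le hp.
have [w qw w0] := lc_ideal_neq0 le hq.
have [[pp _] [qq _]] := (hp, hq).
have sp := lc_ideal_submod le pp.1; have sq := lc_ideal_submod le qq.1.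
have ip := @lc_ideal_integral _ _ le _ pp; have iq := @lc_ideal_integral _ _ le _ qq.
apply: (@fractional_intro _ _ 1) => //.
- split; first by split; [case: sp|case: sq].
  move=> r u v [pu qu] [pv qv]; split; [case: sp|case: sq] => _; exact.
- exists (z * w); rewrite ?mulf_neq0 //; split.
    by rewrite mulrC; apply: Rsubmod_mul => //; apply: iq.
  by apply: Rsubmod_mul => //; apply: ip.
- exact: oner_neq0.
- by move=> u [/ip + _]; rewrite tofrac1 mul1r.
Qed.

End Reduction.

(** * Buchberger's criterion *)

Section BuchbergerCriterion.
Variables (R : idomainType) (n : nat) (le : rel 'X_{1..n}).
Hypotheses (hle : monomial_ordering le) (hD : dedekind_domain R).
Local Notation K := {fraction R}.
Local Notation ppoly := (ppoly R n).

(* Write [1] as a sum of products [u w] with [u] in [S := sum_i B i] and [w] in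
   its inverse, and multiply [y] by the [B i]-components of the [u w]. *)
Lemma fractional_distr (I : finType) (B : I -> set K) (C : set K) (b : I -> K) :
  (forall i, Rsubmod (B i)) -> (forall i, B i `<=` Rimg R) -> Rsubmod C ->
  (forall i, B i (b i)) -> C (\sum_i b i) ->
  exists2 x : I -> K, forall i, B i (x i) /\ C (x i)
                    & \sum_i b i = \sum_i x i.
Proof.
move=> sB iB sC hb; set y := \sum_i b i => Cy.
have [y0|y0] := eqVneq y 0.
  exists (fun=> 0) => [i|]; last by rewrite y0 big1.
  by split; [case: (sB i)|case: sC].
pose S := [set z | exists2 c : I -> K, forall i, B i (c i) & z = \sum_i c i].
have Sy : S y by exists b.
have sS : Rsubmod S.
  split; first by exists (fun=> 0) => [i|]; [case: (sB i)|rewrite big1].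
  move=> r _ _ [c hc ->] [d hd ->].
  exists (fun i => FracField.tofrac r * c i + d i).
    by move=> i; case: (sB i) => _; apply.
  by rewrite big_split mulr_sumr.
have SB i u : B i u -> S u.
  move=> Bu; exists (fun j => if j == i then u else 0).
    by move=> j; case: eqVneq => [->//|_]; case: (sB j).
  by rewrite -big_mkcond big_pred1_eq.
have hS : fractional_ideal S.
  have [hR _ _] := hD.
  apply: (@fractional_intro _ _ 1) => //; [by exists y|exact: oner_neq0|].
  move=> _ [c hc ->]; rewrite tofrac1 mul1r; apply: Rsubmod_sum => [|i _].
    exact: Rimg_submod.
  exact: iB (hc i).
have [t ht et] := fractional_invertible hD hS.
have /choice[c hc] (u : K) : exists c : I -> K, S u ->
    (forall i, B i (c i)) /\ u = \sum_i c i.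
  have [[c hc ec]|nS] := pselect (S u); first by exists c.
  by exists (fun=> 0).
exists (fun i => \sum_(w <- t) c w.1 i * w.2 * y).
  (* Membership in [B i]: [w.2 * y] is in [R] because [y] is in [S]. Membership in [C]:
     [c w.1 i * w.2] is in [R] because [B i] lies in [S]. *)
  move=> i; rewrite big_seq; split; apply: Rsubmod_sum => // w /ht[/hc[hw _] Vw].
    by rewrite -mulrA mulrC; apply: Rsubmod_mul => //; apply: Vw.
  apply: Rsubmod_mul => //; rewrite mulrC; apply: Vw; exact: SB (hw i).
rewrite exchange_big /= -[LHS]mul1r et mulr_suml.
rewrite big_seq [RHS]big_seq; apply: eq_bigr => w /ht[/hc[_ ew] _].
by rewrite {1}ew !mulr_suml.
Qed.

(* Follows from reduction to a member of [G] or to [0], and, unlike reducibility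
   to [0], visibly survives enlarging [G]. *)
Definition good_pair (G : seq ppoly) (p q : ppoly) : Prop :=
  forall d, (spoly le p q).2 d ->
  comb le (mlt le ^~ (mlcm (ldeg le p.1) (ldeg le q.1))) G
    (d *: (spoly le p q).1).

Variables (G : seq ppoly) (p0 : ppoly).
Local Notation g i := (nth p0 G i).
Hypothesis hG : forall p, p \in G -> nonzero_ppoly p.
Hypothesis good : forall i j, (i < j < size G)%N -> good_pair G (g i) (g j).

Let nth_pp i (hi : (i < size G)%N) : nonzero_ppoly (g i) := hG (mem_nth p0 hi).

Let fracG : fractional_family G.
Proof. by move=> p /hG[[]]. Qed.

Section FixedDegree.
Variable m : 'X_{1..n}.

(** The multiple of [g i] with coefficient 1 at [m]. If its leading monomial does not divide [m],
    truncated subtraction makes this junk, which only ever meets the coefficient 0. *)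
Let T i : {mpoly K[n]} :=
  (lcoef le (g i).1)^-1 *: ('X_[m - ldeg le (g i).1] * (g i).1).

(** Equal to 0 when the leading monomial of [g i] does not divide [m], so that sums can run over all
    indices. *)
Let B i : set K :=
  [set u | lc_ideal le (g i) u /\ (u != 0 -> (ldeg le (g i).1 <= m)%MM)].

Let B_submod i : (i < size G)%N -> Rsubmod (B i).
Proof.
move=> hi; have [[fi _] _] := nth_pp hi; have [L0 LD] := lc_ideal_submod le fi.
split; first by split=> //; rewrite eqxx.
move=> r u v [Lu du] [Lv dv]; split; first exact: LD.
have [-> |/du //] := eqVneq u 0; rewrite mulr0 add0r; exact: dv.
Qed.

(** For non-zero [u], the difference [T i - T k] is the S-polynomial times the monomial that shifts
    the lcm to [m]. *)
Let comb_pair i k u : (i < k < size G)%N -> B i u -> B k u ->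
  comb le (mlt le ^~ m) G (u *: (T i - T k)).
Proof.
move=> ik [Li di] [Lk dk]; have [->|u0] := eqVneq u 0.
  by rewrite scale0r; apply: comb0.
set l := mlcm (ldeg le (g i).1) (ldeg le (g k).1).
have lm : (l <= m)%MM by rewrite lem_mlcm di // dk.
have shift a : (a <= l)%MM -> (m - a = (m - l) + (l - a))%MM.
  by move=> al; rewrite addmBA // submK.
have -> : T i - T k = 'X_[m - l] * (spoly le (g i) (g k)).1.
  rewrite /T (shift _ (lem_mlcml _ _)) (shift _ (lem_mlcmr _ _)) !mpolyXD.
  by rewrite -!mulrA mulrBr !scalerAr.
rewrite scalerAr; apply: comb_XM (good ik _); last by split.
by move=> a al; rewrite -[X in mlt _ _ X](submK lm); apply: mlt_add.
Qed.

(* The syzygies of the leading coefficients are generated by pairs: the last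
   [b k] lies in the intersection of [B k] and [sum_(i < k) B i], which by
   distributivity is the sum of the intersections of [B k] with the [B i]. *)
Lemma comb_syzygy k (b : 'I_k -> K) : (k <= size G)%N ->
  (forall i : 'I_k, B i (b i)) -> \sum_(i < k) b i = 0 ->
  comb le (mlt le ^~ m) G (\sum_(i < k) b i *: T i).
Proof.
elim: k b => [|k ih] b hk hb; first by rewrite !big_ord0 => _; apply: comb0.
rewrite !big_ord_recr /= => /eqP; rewrite addr_eq0 => /eqP eb.
pose w := widen_ord (leqnSn k).
have ltG (i : 'I_k) : (i < size G)%N by apply: ltn_trans hk.
have sk := B_submod hk.
have [|||||x hx ex] := @fractional_distr _ (fun i : 'I_k => B i) (B k) (b \o w).
- by move=> i; apply: B_submod.
- move=> i u [Lu _]; have [pi _] := nth_pp (ltG i).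
  exact: lc_ideal_integral pi _ Lu.
- exact: sk.
- by move=> i; apply: (hb (w i)).
- by rewrite /= eb; apply: Rsubmod_opp => //; apply: (hb ord_max).
have -> : b ord_max = - \sum_i x i by rewrite -ex /= eb opprK.
(* Moving each [x i] from [T k] to [T i] leaves coefficients of sum 0 on the first [k] multiples,
   plus differences handled by [comb_pair]. *)
have -> : \sum_(i < k) b (w i) *: T i + (- \sum_i x i) *: T k =
    \sum_(i < k) (b (w i) - x i) *: T i + \sum_(i < k) x i *: (T i - T k).
  rewrite -big_split scaleNr scaler_suml -sumrN -big_split /=.
  apply: eq_bigr => i _; rewrite scalerBl scalerBr addrA subrK.
  by [].
apply: comb_add.
  apply: ih; first exact: ltnW.
    move=> i; apply: Rsubmod_add (B_submod (ltG i)) (hb (w i)) _.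
    by apply: Rsubmod_opp; [apply: B_submod|case: (hx i)].
  by rewrite sumrB -ex subrr.
by apply: comb_sum => i _; have [Bi Bk] := hx i; apply: comb_pair => //; rewrite ltn_ord.
Qed.

(** Summands with leading exponent exactly [m] are scalar multiples of the [T i]; all others go into
    [w]. *)
Lemma comb_top f : comb le (le^~ m) G f ->
  exists b : 'I_(size G) -> K, exists w,
  [/\ forall i : 'I_(size G), B i (b i), comb le (mlt le ^~ m) G w
    & f = \sum_(i < size G) b i *: T i + w].
Proof.
elim=> [|c a q f' qG qc qm _ [b [w [hb hw ->]]]].
  exists (fun=> 0), 0; split; last by rewrite addr0 big1 // => i _; rewrite scale0r.
    by move=> i; case: (B_submod (ltn_ord i)).
  exact: comb0.
have [qa|qa] := eqVneq (a + ldeg le q.1)%MM m; last first.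
  exists b, (c *: ('X_[a] * q.1) + w); split=> //; last by rewrite addrCA.
  by apply: comb_cons => //; rewrite /mlt /= qa.
have hi : (index q G < size G)%N by rewrite index_mem.
have gi : g (index q G) = q by rewrite nth_index.
pose i0 := Ordinal hi; pose e i := if i == i0 then c * lcoef le q.1 else 0.
exists (fun i => e i + b i), w; split=> //.
  move=> i; apply: Rsubmod_add (B_submod (ltn_ord i)) _ (hb i).
  rewrite /e; case: eqVneq => [->|_]; last by case: (B_submod (ltn_ord i)).
  rewrite /B /= gi; split; first by exists c.
  by move=> _; rewrite -qa lem_addl.
rewrite addrA; congr (_ + _).
under [RHS]eq_bigr do rewrite scalerDl.
rewrite big_split /=; congr (_ + _).
rewrite (bigD1 i0) //= [X in _ + X]big1 => [|i /negPf ni]; last first.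
  by rewrite /e ni scale0r.
have [_ q0] := hG qG.
by rewrite addr0 /e eqxx /T gi scalerA mulfK ?lcoef_neq0 // -qa addmK.
Qed.

Lemma coef_comb_top (b : 'I_(size G) -> K) : (forall i : 'I__, B i (b i)) ->
  (\sum_(i < size G) b i *: T i)@_m = \sum_i b i.
Proof.
move=> hb; rewrite raddf_sum; apply: eq_bigr => i _.
rewrite /= mcoeffZ; have [->|b0] := eqVneq (b i) 0; first by rewrite mul0r.
have [_ /(_ b0) im] := hb i; have [_ g0] := nth_pp (ltn_ord i).
by rewrite mcoeffZ mcoeff_shift // mulVf ?mulr1 // lcoef_neq0.
Qed.

Lemma Lt_fam_top (b : 'I_(size G) -> K) : (forall i : 'I__, B i (b i)) ->
  Lt_fam le G ((\sum_i b i) *: 'X_[m]).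
Proof.
have Lt0 p : p \in G -> Lt1 le p 0.
  move=> pG; exists 0; rewrite ?mul0r // => a; rewrite mcoeff0.
  by have [] := fractional_submod (fracG pG).
have LtD p : p \in G -> forall u v, Lt1 le p u -> Lt1 le p v -> Lt1 le p (u + v).
  move=> /fracG/fractional_submod sp _ _ [u hu <-] [v hv <-].
  by exists (u + v); [apply: poly_over_add|rewrite mulrDl].
move=> hb; rewrite scaler_suml; elim/big_ind: _.
- exact: big_setsum0.
- exact: big_setsum_add.
move=> i _; have [b0|b0] := eqVneq (b i) 0.
  by rewrite b0 scale0r; apply: big_setsum0.
have [[c gc ec] /(_ b0) im] := hb i; rewrite -ec.
have giG : g i \in G by apply: mem_nth.
apply: mem_big_setsum (giG) _ _ _ => //.
exists (c *: 'X_[m - ldeg le (g i).1]).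
  by apply: poly_over_scaleX => //; case: (fractional_submod (fracG giG)).
by rewrite /lterm -scalerAr -scalerAl scalerA mulrC -mpolyXD submK.
Qed.

End FixedDegree.

Lemma lterm_in_Lt_fam f : comb le predT G f -> f != 0 -> Lt_fam le G (lterm le f).
Proof.
move=> hf f0.
have [|m hm mmin] := mle_minimal hle (S := [set m | comb le (le^~ m) G f]).
  by have [/eqP|[m _ hm]] := comb_bound hle hf; [rewrite (negPf f0)|exists m].
have nlt : ~ comb le (mlt le ^~ m) G f.
  move=> /(comb_bound hle)[/eqP|[a am ha]]; first by rewrite (negPf f0).
  exact: mmin ha.
have [b [w [hb hw ef]]] := comb_top hm.
have wm : supp_in (mlt le ^~ m) w.
  by apply: comb_supp hw => // a c; apply: mle_lt_trans.
have fm : f@_m = \sum_i b i.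
  by rewrite ef mcoeffD coef_comb_top // (supp_in_mlt_coef wm) addr0.
have fm0 : f@_m != 0.
  (* If the coefficient at [m] vanished, the [b i] would form a syzygy, and rewriting it would
     contradict the minimality of [m]. *)
  apply/eqP => fm0; apply: nlt; rewrite ef; apply: comb_add => //.
  by apply: comb_syzygy => //; rewrite -fm.
have dm : ldeg le f = m.
  apply: ldegP => //; apply: comb_supp hm => // a c; exact: mle_trans.
by rewrite /lterm /lcoef dm fm; apply: Lt_fam_top.
Qed.

Lemma buchberger_criterion (F : seq ppoly) : {subset F <= G} ->
  (forall p c, p \in G -> p.2 c -> comb le predT F (c *: p.1)) ->
  pseudo_groebner_basis le G (pp_span F).
Proof.
move=> FG GF; have fracF : fractional_family F by move=> p /FG/fracG.
have spanGF f : comb le predT G f -> pp_span F f.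
  by move=> hf; apply/(pp_spanP le _ fracF); apply: comb_subst hf GF.
split=> //; first by move=> f /(pp_spanP le _ fracG)/spanGF.
apply/seteqP; split.
  move=> _ [s hs ->]; rewrite big_seq; elim/big_ind: _.
  - apply: big_setsum0 => p /fracG/fractional_submod[p00 _].
    by exists 0; rewrite ?mul0r // => a; rewrite mcoeff0.
  - apply: big_setsum_add => p /fracG/fractional_submod sp _ _ [u hu <-] [v hv <-].
    by exists (u + v); [apply: poly_over_add|rewrite mulrDl].
  move=> [a _] /hs[/= ha [f [hf /eqP f0] <-]].
  apply: (big_setsum_stable (f := *%R a)); first exact: mulr0.
  - exact: mulrDr.
  - move=> p /fracG/fractional_submod sp _ [u hu <-].
    by exists (a * u); [apply: poly_over_mul|rewrite mulrA].
  apply: lterm_in_Lt_fam => //; move/(pp_spanP le _ fracF): hf.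
  exact: comb_mono.
apply: big_setsum_min.
- by exists [::]; rewrite ?big_nil.
- move=> _ _ [s hs ->] [t ht ->]; exists (s ++ t); last by rewrite big_cat.
  by move=> p; rewrite mem_cat => /orP[/hs|/ht].
move=> p pG _ _ [a ha <-].
have [_ pn0] := hG pG.
(* Neither must [a@_k] lie in [R] nor [p.1] in the span, so the whole monomial is absorbed into the
   element whose leading term is taken, with cofactor 1. *)
exists [seq (1, lterm le (a@_k *: ('X_[k] * p.1))) | k <- msupp a].
  move=> _ /mapP[k ka ->] /=; split; first by rewrite -mpolyX0; apply: poly_overX.
  rewrite mcoeff_msupp in ka.
  exists (a@_k *: ('X_[k] * p.1)) => //; split; first exact/spanGF/comb1.
  apply/eqP; rewrite scaler_eq0 negb_or ka mulf_neq0 //.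
  by rewrite -msupp_eq0 msuppX.
rewrite big_map [in LHS](mpolyE a) mulr_suml big_seq [RHS]big_seq.
apply: eq_bigr => k; rewrite mcoeff_msupp => ka /=.
by rewrite mul1r lterm_scaleXM // scalerAl.
Qed.

End BuchbergerCriterion.

(** * Dickson's lemma *)

Section Dickson.

Lemma strict_homo (phi : nat -> nat) : (forall k, (phi k < phi k.+1)%N) ->
  {homo phi : i j / (i <= j)%N}.
Proof. by move=> h; apply: homo_leq => // [? ? ?|k]; [apply: leq_trans|apply: ltnW]. Qed.

Lemma nondecreasing_subseq (v : nat -> nat) : exists2 phi : nat -> nat,
  forall k, (phi k < phi k.+1)%N & forall k, (v (phi k) <= v (phi k.+1))%N.
Proof.
have /choice[f hf] N : exists m, (N <= m)%N /\ forall l, (N <= l)%N -> (v m <= v l)%N.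
  have ex : exists x, `[< exists2 m, (N <= m)%N & v m = x >].
    by exists (v N); apply/asboolP; exists N.
  case: (ex_minnP ex) => x /asboolP[m Nm <-] mmin; exists m; split=> // l Nl.
  by apply: mmin; apply/asboolP; exists l.
(* [f N] is a position from [N] on where [v] is least; each search starts just after the previous
   hit. *)
pose phi k := iter k (fun x => f x.+1) (f 0%N).
exists phi => k; first by have [] := hf (phi k).+1.
have phif : exists N, phi k = f N by case: k => [|k]; eexists.
have [N eN] := phif; have [Nf fmin] := hf N; rewrite eN; apply: fmin.
by apply: leq_trans (ltnW (proj1 (hf (phi k).+1))); rewrite eN.
Qed.

(** One coordinate at a time: a further subsequence keeps the earlier coordinates nondecreasing. *)
Lemma dickson n (u : nat -> 'X_{1..n}) : exists2 phi : nat -> nat,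
  forall k, (phi k < phi k.+1)%N & forall k, (u (phi k) <= u (phi k.+1))%MM.
Proof.
suff main j : exists2 phi : nat -> nat, forall k, (phi k < phi k.+1)%N &
    forall i : 'I_n, (i < j)%N -> forall k, (u (phi k) i <= u (phi k.+1) i)%N.
  have [phi h1 h2] := main n.
  by exists phi => // k; apply/mnm_lepP => i; apply: h2.
elim: j => [|j [phi phiS hphi]]; first by exists id.
have [jn|nj] := ltnP j n; last first.
  by exists phi => // i _; apply: hphi; apply: leq_trans nj.
have [psi psiS hpsi] := nondecreasing_subseq (fun k => u (phi k) (Ordinal jn)).
exists (phi \o psi) => [k|i]; first exact: leq_trans (phiS _) (strict_homo phiS (psiS k)).
rewrite ltnS leq_eqVlt => /predU1P[ij k|ij k].
  by have -> : i = Ordinal jn; [apply: val_inj|apply: hpsi].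
have mono : {homo (fun l => u (phi l) i) : a b / (a <= b)%N}.
  by apply: homo_leq => // [? ? ?|l]; [apply: leq_trans|apply: hphi].
exact: mono (ltnW (psiS k)).
Qed.

End Dickson.

(** * Invariants and termination of the procedure *)

Section Buchberger.
Variables (R : idomainType) (n : nat) (le : rel 'X_{1..n}).
Hypotheses (hle : monomial_ordering le) (hD : dedekind_domain R).
Local Notation K := {fraction R}.
Local Notation ppoly := (ppoly R n).
Variables (F : seq ppoly) (p0 : ppoly).
Hypothesis hF : forall p, p \in F -> nonzero_ppoly p.
Implicit Types (s : bb_state R n) (G : seq ppoly).

(* Along a subsequence with leading exponents increasing for divisibility, the
   ideals against which minimality is tested form an ascending chain. *)
Lemma no_minimal_sequence (g : nat -> ppoly) N :
  (forall i, pseudo_polynomial (g i)) ->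
  ~ (forall i, (N <= i)%N -> minimal le (mkseq g i) (g i)).
Proof.
move=> hg hmin; have [hR _ _] := hD.
have sg p : lc_ideal le (g p) 0 by case: (lc_ideal_submod le (hg p).1).
have hs k p : p \in mkseq g k -> Rsubmod (lc_ideal le p).
  by case/mapP=> j _ ->; apply: lc_ideal_submod; case: (hg j).
have [phi phiS hphi] := dickson (fun k => ldeg le (g (N + k)%N).1).
pose psi k := (N + phi k)%N.
pose D k : set R := [set r |
  (\big[@setsum _/[set 0]]_(p <- mkseq g (psi k) |
     (ldeg le p.1 <= ldeg le (g (psi k)).1)%MM) lc_ideal le p)
  (FracField.tofrac r)].
have psiS k : (psi k < psi k.+1)%N by rewrite ltn_add2l.
have [|k|l hl] := @noetherian_chain R D hR.
- move=> k; split; first by rewrite /D /= tofrac0; apply: big_setsum0 => p /hs[].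
  move=> a u v Du Dv; rewrite /D /= tofracD tofracM; apply: big_setsum_add => //.
    by move=> p /hs hp x y; apply: Rsubmod_add.
  apply: (big_setsum_stable (f := *%R (FracField.tofrac a))) Du; first exact: mulr0.
    exact: mulrDr.
  by move=> p /hs hp x; apply: Rsubmod_mul => //; exists a.
- move=> r; apply: big_setsum_min.
  + by apply: big_setsum0 => p /hs[].
  + by apply: big_setsum_add => p /hs hp x y; apply: Rsubmod_add.
  move=> p /mapP[j]; rewrite mem_iota /= add0n => jk -> pk.
  apply: mem_big_setsum => [q /hs[]//||]; last exact: lepm_trans pk (hphi k).
  by apply/mapP; exists j; rewrite // mem_iota /= add0n (ltn_trans jk).
(* Where the chain stalls, the leading coefficient ideal of entry [psi l] lies in [D l.+1], hence in
   [D l], which makes that entry reducible. *)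
apply: (hmin (psi l)); first exact: leq_addr.
move=> x hx; have [r _ rx] := lc_ideal_integral (hg (psi l)) hx.
rewrite -rx; apply: hl; rewrite /D /= rx.
apply: mem_big_setsum hx => [q /hs[]//||]; last exact: hphi.
by apply/mapP; exists (psi l); rewrite // mem_iota /= add0n psiS.
Qed.

(** [inv_input], [inv_span] and [inv_good] feed the criterion once no pair is pending; [inv_pairs]
    confines the pending pairs to finitely many; [inv_minimal] keeps, for each entry added by the
    loop, the prefix it was tested against. *)
Record bb_inv s : Prop := BBInv {
  inv_nonzero : forall p, p \in s.2 -> nonzero_ppoly p;
  inv_input : {subset F <= s.2};
  inv_span : forall p c, p \in s.2 -> p.2 c -> comb le predT F (c *: p.1);
  inv_pairs : forall p q, s.1 (p, q) -> p \in s.2 /\ q \in s.2;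
  inv_good : forall i j, (i < j < size s.2)%N ->
    s.1 (nth p0 s.2 i, nth p0 s.2 j) \/
    good_pair le s.2 (nth p0 s.2 i) (nth p0 s.2 j);
  inv_minimal : forall i, (size F <= i < size s.2)%N ->
    minimal le (take i s.2) (nth p0 s.2 i) }.

Lemma bb_inv_init : bb_inv (bb_init F).
Proof.
split=> //=.
- by move=> p c pF pc; apply: comb_gen.
- by move=> p q [i [j [_ [-> ->]]]]; split; apply: mem_tnth.
- move=> i j /andP[ij jF]; left; exists (Ordinal (ltn_trans ij jF)), (Ordinal jF).
  by split=> //; rewrite !(tnth_nth p0).
- by move=> i /andP[Fi iF]; move: (leq_ltn_trans Fi iF); rewrite ltnn.
Qed.

Lemma good_pair_mono G G' p q : {subset G <= G'} -> good_pair le G p q ->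
  good_pair le G' p q.
Proof. by move=> GG' h d /h; apply: comb_mono. Qed.

Lemma bb_inv_fractional s : bb_inv s -> fractional_family s.2.
Proof. by move=> hs p /(inv_nonzero hs)[[]]. Qed.

Lemma bb_inv_spoly Gt G p q : bb_inv (Gt, G) -> Gt (p, q) ->
  [/\ p \in G, q \in G, fractional_ideal (spoly le p q).2
    & supp_in (mlt le ^~ (mlcm (ldeg le p.1) (ldeg le q.1))) (spoly le p q).1].
Proof.
move=> hs pq; have [/= pG qG] := inv_pairs hs pq.
have hp := inv_nonzero hs pG; have hq := inv_nonzero hs qG.
have [hR _ _] := hD.
split=> //; first exact: spoly_fractional.
by apply: spoly_supp; [|case: hp|case: hq].
Qed.

Lemma bb_inv_zero Gt G p q h : bb_inv (Gt, G) -> Gt (p, q) ->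
  reduces le G (spoly le p q) h -> h.1 = 0 -> bb_inv (Gt `\ (p, q), G).
Proof.
move=> hs pq red h0; have fG := bb_inv_fractional hs.
have [pG qG _ sm] := bb_inv_spoly hs pq.
have [e2 _ hc] := reduces_comb hle fG red sm.
case: (hs) => /= i1 i2 i3 i4 i5 i6; split=> //=.
  by move=> p' q' [] /i4.
(* Pairs are removed by value, so with repeated entries several index pairs may go at once; all of
   them become good. *)
move=> i j ij; have [epq|npq] := pselect ((nth p0 G i, nth p0 G j) = (p, q)).
  right; case: epq => -> -> d /hc.
  by rewrite h0 subr0.
by have [hij|hij] := i5 i j ij; [left|right].
Qed.

Lemma bb_inv_new Gt G p q h : bb_inv (Gt, G) -> Gt (p, q) ->
  reduces le G (spoly le p q) h -> h.1 != 0 -> minimal le G h ->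
  bb_inv ((Gt `\ (p, q)) `|` [set (f, h) | f in [set` G]], rcons G h).
Proof.
move=> hs pq red h0 hmin; have fG := bb_inv_fractional hs.
have [pG qG sfrac sm] := bb_inv_spoly hs pq.
have [/= e2 hm hc] := reduces_comb hle fG red sm.
case: (hs) => /= i1 i2 i3 i4 i5 i6.
have [[_ pn0] [_ qn0]] := (i1 p pG, i1 q qG).
have fF : fractional_family F by move=> f /i2/fG.
have hspan c : h.2 c -> comb le predT F (c *: h.1).
  (* The remainder is the S-polynomial minus what the reduction subtracted, and both parts are
     combinations of [F]. *)
  rewrite e2 => sc; have -> : c *: h.1 =
      c *: (spoly le p q).1 - c *: ((spoly le p q).1 - h.1).
    by rewrite -scalerBr subKr.
  apply: comb_sub => //.
    by apply: comb_subst (i3); apply: spoly_comb.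
  apply: comb_subst (i3); apply: comb_mono (hc c _) => //; by rewrite e2.
have hh : nonzero_ppoly h.
  split=> //; split; first by rewrite e2.
  by move=> c /hspan; apply: comb_integral => f /hF[].
have GG : {subset G <= rcons G h} by move=> x xG; rewrite mem_rcons inE xG orbT.
split=> /=.
- by move=> f; rewrite mem_rcons inE => /predU1P[->|/i1].
- by move=> f /i2/GG.
- by move=> f c; rewrite mem_rcons inE => /predU1P[-> /hspan|/i3 hf /hf].
- move=> p' q' [[/i4[/GG pG' /GG qG'] _]|[f /= fG' [<- <-]]]; first by split.
  by split; [apply: GG|rewrite mem_rcons mem_head].
- move=> i j; rewrite size_rcons ltnS => /andP[ij jG].
  rewrite !nth_rcons (leq_trans ij jG).
  move: jG; rewrite leq_eqVlt => /predU1P[ej|jG].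
    rewrite ej ltnn eqxx; left; right; exists (nth p0 G i) => //.
    by apply: mem_nth; rewrite -ej.
  rewrite jG; have [epq|npq] := pselect ((nth p0 G i, nth p0 G j) = (p, q)).
    right; case: epq => -> -> d sd.
    rewrite -[(spoly le p q).1](subrK h.1) scalerDr; apply: comb_add.
      by apply: comb_mono (hc d sd).
    (* The remainder is now a member of the family, with leading exponent below the lcm, so it is
       itself an admissible summand. *)
    apply: comb_gen; rewrite ?mem_rcons ?mem_head ?e2 //.
    exact: (supp_in_ldeg le h0 hm).
  have [|hij|hij] := i5 i j; first by rewrite ij.
    by left; left; split.
  by right; apply: good_pair_mono hij.
move=> i; rewrite size_rcons ltnS => /andP[Fi].
rewrite leq_eqVlt => /predU1P[->|iG].
  by rewrite -cats1 take_size_cat // nth_cat ltnn subnn.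
rewrite -cats1 takel_cat ?(ltnW iG) // nth_cat iG; apply: i6.
by rewrite Fi.
Qed.

Lemma bb_inv_step s s' : bb_inv s -> bb_step le s s' -> bb_inv s'.
Proof.
by move=> hs st; case: st hs => *; [apply: bb_inv_zero|apply: bb_inv_new]; eauto.
Qed.

Lemma bb_inv_reachable s : bb_reachable le F s -> bb_inv s.
Proof.
move=> h; have := bb_inv_init; elim: h => // [s1 s2 st /bb_inv_step|s1 s2 s3 _ h1 _ h2].
  exact.
by move=> /h1/h2.
Qed.

Lemma bb_progress s : bb_inv s -> s.1 !=set0 -> exists s', bb_step le s s'.
Proof.
case: s => Gt G hs [[p q] /= pq].
have [_ _ sfrac _] := bb_inv_spoly hs pq.
have [h red [h0|[h0 hmin]]] :=
  reduces_to_minimal hle hD (bb_inv_fractional hs) sfrac.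
  by eexists; apply: bb_step_zero red h0.
by eexists; apply: bb_step_new red h0 hmin.
Qed.

Lemma bb_correct s : bb_inv s -> s.1 = set0 ->
  pseudo_groebner_basis le s.2 (pp_span F).
Proof.
move=> hs s0; apply: (@buchberger_criterion _ _ _ hle hD _ p0).
- exact: inv_nonzero.
- by move=> i j /(inv_good hs)[|//]; rewrite s0.
- exact: inv_input.
- exact: inv_span.
Qed.

Lemma count_lt (T : eqType) (P Q : pred T) (t : seq T) x : subpred P Q ->
  x \in t -> Q x -> ~~ P x -> (count P t < count Q t)%N.
Proof.
move=> PQ; elim: t => //= y t ih; rewrite inE => /predU1P[<-|xt] Qx nPx.
  by rewrite Qx (negPf nPx) add0n add1n ltnS sub_count.
apply: leq_ltn_trans (_ : (Q y + count P t < _)%N); last by rewrite ltn_add2l ih.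
by rewrite leq_add2r; case Py: (P y) => //; rewrite (PQ y Py).
Qed.

Section Run.
Variable s : nat -> bb_state R n.
Hypotheses (s0 : s 0%N = bb_init F) (sS : forall k, bb_step le (s k) (s k.+1)).

Lemma run_inv k : bb_inv (s k).
Proof.
elim: k => [|k ih]; first by rewrite s0; apply: bb_inv_init.
exact: bb_inv_step (sS k).
Qed.

Lemma run_prefix k l : (k <= l)%N ->
  exists t, (s l).2 = (s k).2 ++ t.
Proof.
move=> /subnK <-; elim: (l - k)%N => [|d [t ih]]; first by exists [::]; rewrite cats0.
rewrite addSn; case: (sS (d + k)) ih => //= Gt G p q h _ _ _.
  by move=> ->; exists t.
by move=> _ ->; exists (rcons t h); rewrite rcons_cat.
Qed.

(** If the family stopped growing at stage [k], every later step would use up one of the finitely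
    many pairs of its entries. *)
Lemma run_growth k : exists2 l, (k <= l)%N & (size (s k).2 < size (s l).2)%N.
Proof.
apply: contrapT => nogrow.
have const l : (k <= l)%N -> (s l).2 = (s k).2.
  move=> kl; have [t et] := run_prefix kl; rewrite et.
  suff /nilP -> : size t == 0%N by rewrite cats0.
  rewrite -leqn0 leqNgt; apply/negP => t0; apply: nogrow; exists l => //.
  by rewrite et size_cat -{1}[size _]addn0 ltn_add2l.
pose L := [seq (p, q) | p <- (s k).2, q <- (s k).2].
pose cnt l := count (fun pq => `[< (s l).1 pq >]) L.
have cntS l : (k <= l)%N -> (cnt l.+1 < cnt l)%N.
  move=> kl; have e := const _ kl; have e' := const _ (leqW kl).
  have il := run_inv l; rewrite /cnt.
  case: (sS l) e e' il => [Gt G p q h pq _ _|Gt G p q h _ _ _ _] /= e e' il.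
    apply: (@count_lt _ _ _ _ (p, q)).
    - by move=> x /asboolP[? _]; apply/asboolP.
    - by have [/= ? ?] := inv_pairs il pq; apply/allpairsP; exists (p, q); rewrite -e.
    - exact/asboolP.
    - by apply/negP => /asboolP[_]; apply.
  by move: (congr1 size e'); rewrite -e size_rcons => /esym/n_Sn.
have desc d : (cnt (d + k) + d <= cnt k)%N.
  elim: d => [|d ih]; first by rewrite addn0.
  by apply: leq_trans ih; rewrite addSn addnS -addSn leq_add2r cntS // leq_addl.
have := desc (cnt k).+1; rewrite addnS => /(leq_trans (_ : (cnt k < _)%N)).
by rewrite ltnn ltnS leq_addl => /(_ isT).
Qed.

Lemma run_unbounded B : exists k, (B < size (s k).2)%N.
Proof.
elim: B => [|B [k hk]]; last by have [l _ hl] := run_growth k; exists l; apply: leq_trans hl.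
by have [l _ hl] := run_growth 0; exists l; apply: leq_trans hl.
Qed.

Lemma run_absurd : False.
Proof.
(* [kap i] is a stage at which position [i] is filled; families only grow at the end, so the entry
   there no longer changes. *)
have [kap hkap] := choice run_unbounded.
pose g i := nth p0 (s (kap i)).2 i.
have gE i l : (i < size (s l).2)%N -> nth p0 (s l).2 i = g i.
  move=> il; rewrite /g; have := hkap i.
  have [/run_prefix[t ->]|/ltnW/run_prefix[t ->]] := leqP l (kap i).
    by rewrite nth_cat il.
  by rewrite nth_cat => ->.
have mkE i : mkseq g i = take i (s (kap i)).2.
  have hi := hkap i; apply: (@eq_from_nth _ p0).
    by rewrite size_mkseq size_takel // ltnW.
  move=> j; rewrite size_mkseq => ji.
  by rewrite nth_mkseq // nth_take // gE // (ltn_trans ji).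
apply: (@no_minimal_sequence g (size F)).
  by move=> i; have [] := inv_nonzero (run_inv (kap i)) (mem_nth p0 (hkap i)).
by move=> i Fi; rewrite mkE; apply: (inv_minimal (run_inv _)); rewrite Fi hkap.
Qed.

End Run.

End Buchberger.

Theorem mainTheorem3 (R : idomainType) (n : nat) (le : rel 'X_{1..n})
    (F : seq (ppoly R n))
    (hR : dedekind_domain R)
    (hle : monomial_ordering le)
    (hF : forall f, f \in F -> nonzero_ppoly f) :
  [/\ (* step (a) can always be carried out *)
      forall s, bb_reachable le F s -> s.1 !=set0 ->
        exists s', bb_step le s s',
      (* no sequence of choices makes the loop run forever *)
      ~ (exists s : nat -> bb_state R n,
           s 0%N = bb_init F /\ forall k, bb_step le (s k) (s k.+1))
    & (* the output is correct *)
      forall s, bb_reachable le F s -> s.1 = set0 ->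
        pseudo_groebner_basis le s.2 (pp_span F)].
Proof.
(* An arbitrary default for [nth]. *)
pose p0 : ppoly R n := (0, set0).
split=> [s /(bb_inv_reachable hle hR p0 hF)|[s [s0 sS]]|
         s /(bb_inv_reachable hle hR p0 hF)].
- exact: bb_progress.
- exact: (run_absurd hle hR p0 hF s0 sS).
- exact: bb_correct.
Qed.
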